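(* Consider an instance of the Ring Loading Problem: an undirected ring (cycle) on nodes $1,2,\dots,n$ (numbered clockwise) with demands $d_{i,j}\ge 0$ for each pair of nodes $i<j$, and let $D:=\max_{i,j} d_{i,j}$. Let a split routing be given, i.e., for every pair $i<j$ the demand $d_{i,j}$ is divided into a nonnegative amount sent along the clockwise path $i,i+1,\dots,j$ and a nonnegative amount sent along the counterclockwise path $i,i-1,\dots,j$, summing to $d_{i,j}$; the load of an edge is the total flow routed over it. Then there exists an unsplittable routing (every demand $d_{i,j}$ is sent entirely along one of its two paths) such that for every edge of the ring, its load in the unsplittable routing exceeds its load in the given split routing by at most $\frac{19}{14}D$. *)

(* Defs.v *)
From mathcomp Require Import all_boot all_order all_algebra.
From mathcomp Require Import reals.

Set Implicit Arguments.
Unset Strict Implicit.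
Unset Printing Implicit Defensive.
Import Order.TTheory GRing.Theory Num.Theory.
Local Open Scope ring_scope.

(* The nodes of the ring are numbered clockwise 0, ..., n-1.  Its n edges are
   indexed by 'I_n as well: edge k joins node k and its clockwise successor
   ordS k, so that edge n-1 joins node n-1 and node 0.
   Data indexed by a pair of nodes (i, j) are only ever read for i < j. *)

(* Edges k, k+1 visited by the walk i, i+1, ..., j, for i < j. *)
Definition cw_path (n : nat) (i j : 'I_n) : {set 'I_n} :=
  [set k : 'I_n | (i <= k < j)%N].

(* For i < j, the walk i, i-1, ..., 0, n-1, ..., j visits the edges
   i-1, ..., 0 and then n-1, ..., j. *)
Definition ccw_path (n : nat) (i j : 'I_n) : {set 'I_n} :=
  [set k : 'I_n | (k < i)%N || (j <= k)%N].

(* Amounts sent along the clockwise and counterclockwise paths of each pair. *)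
Record routing (R : realType) (n : nat) := Routing {
  cw_flow : 'I_n -> 'I_n -> R;
  ccw_flow : 'I_n -> 'I_n -> R }.

Definition split_routing (R : realType) (n : nat) (d : 'I_n -> 'I_n -> R)
    (r : routing R n) : Prop :=
  forall i j : 'I_n, (i < j)%N ->
    [/\ 0 <= cw_flow r i j, 0 <= ccw_flow r i j
      & cw_flow r i j + ccw_flow r i j = d i j].

Definition unsplittable_routing (R : realType) (n : nat)
    (d : 'I_n -> 'I_n -> R) (r : routing R n) : Prop :=
  forall i j : 'I_n, (i < j)%N ->
    (cw_flow r i j = d i j /\ ccw_flow r i j = 0) \/
    (cw_flow r i j = 0 /\ ccw_flow r i j = d i j).

Definition load (R : realType) (n : nat) (r : routing R n) (e : 'I_n) : R :=
  \sum_(i < n) \sum_(j < n | (i < j)%N)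
    ((if e \in cw_path i j then cw_flow r i j else 0)
     + (if e \in ccw_path i j then ccw_flow r i j else 0)).

(* The initial value 0 does not affect the maximum of nonnegative demands; it
   only makes the maximum 0 when there is no pair of distinct nodes. *)
Definition max_demand (R : realType) (n : nat) (d : 'I_n -> 'I_n -> R) : R :=
  \big[Num.max/0]_(i < n) \big[Num.max/0]_(j < n | (i < j)%N) d i j.

(* Main.v *)
(* Moving flow along two split demands whose paths do not cross, until one of
   them is unsplit, increases no load.  So let the split demands cross pairwise,
   and sort them by first endpoint.  If [u] and [v] are the two parts of a
   demand, an unsplittable routing picks [z = v] or [z = - u] for each of them,
   and every edge load changes by plus or minus [2 P_k - P_m], where [P_k] is
   the sum of the first [k] of the [m] values [z].

   Scale the largest demand to 14; the target is [|2 P_k - P_m| <= 19].  A walk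
   with steps [z], staying in the strip [0, 14], from [x] to [y], gives
   [2 P_k - P_m = 2 p_k - (x + y)] and is fine when [9 <= x + y <= 19].
   Rotating the cyclic sequence, one demand is kept aside to close the walk,
   which leaves several intervals of good values of [x + y].  A demand in
   [4, 10] closes every walk.  Otherwise merge adjacent demands below 4, so that
   small (< 4) and big (> 10) demands alternate; it suffices to find a walk with
   one jump [h], [|h| <= 2], and [x + y] in a good interval shrunk by [|h|].
   If there is none, let [n t] be the number of good intervals to the left of
   [t].  At each time, [n (x + y)] splits as [k p x + l p y] over the positions
   [p] through which [x] is connected to [y], and [k p x] has a drop between
   [p] and [p + (u + v)] after a big demand [(u, v)].  The drop is positive at
   the first big demand, stays positive at the next ones, and at the end
   contradicts the monotonicity of [n]. *)

Require Import Defs.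
From mathcomp Require Import all_boot all_order all_algebra.
From mathcomp Require Import reals.
From mathcomp Require Import boolp.
From mathcomp Require Import ring lra zify.
Set Implicit Arguments.
Unset Strict Implicit.
Unset Printing Implicit Defensive.
Import Order.TTheory GRing.Theory Num.Theory.
Local Open Scope ring_scope.

(* [lra] slows down with irrelevant hypotheses. *)
Ltac irrelevant T := lazymatch T with
  | is_true (_ <= _) => fail
  | is_true (_ < _) => fail
  | ?x = _ => tryif is_var x then fail else idtac
  | _ /\ _ => fail
  | _ => idtac end.
Ltac arith := repeat match goal with H : forall _, _ |- _ => clear H end;
  lazymatch goal with
  | |- is_true _ => first [
      repeat match goal with H : ?T |- _ =>
        match type of T with Prop => irrelevant T; clear H end end; lra
      | lra]
  | _ => lra end.

Lemma le_or_lt (R : realFieldType) (x y : R) : x <= y \/ y < x.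
Proof. by case: lerP; [left|right]. Qed.

Definition inW (R : realFieldType) (p : R) := 0 <= p /\ p <= 14.

Definition near (R : realFieldType) (g p p' : R) := p - p' <= g /\ p' - p <= g.

Ltac bnd := try lazymatch goal with
  | |- is_true (_ <= _) => arith
  | |- is_true (_ < _) => arith
  | |- inW _ => first [done|by split; arith]
  | |- near _ _ _ => by split; arith
  | |- _ => done
  end.

(** * Walks in the strip: not every walk with one jump is bad *)

Section Strip.
Variable R : realFieldType.
Implicit Types (d p q x y g u v : R) (s : seq (R * R)) (a b : R * R).

(* At a demand [(u, v)] the walk goes down by [u] or up by [v]. *)
Definition okstep a := [&& 0 <= a.1, 0 <= a.2 & a.1 + a.2 <= 14].
Definition small a := okstep a && (a.1 + a.2 < 4).
Definition big a := okstep a && (10 < a.1 + a.2).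

(* Walks inside the strip: [ends s p y] says that [y] can be reached from [p]
   through the demands [s]; in [push X a], [X p x] means that the start [x] can
   reach the position [p]. *)
Fixpoint ends s p y : Prop :=
  if s is (u, v) :: s' then
    (u <= p /\ ends s' (p - u) y) \/ (p + v <= 14 /\ ends s' (p + v) y)
  else y = p.

Definition push (X : R -> R -> Prop) a : R -> R -> Prop := fun q x =>
  (q + a.1 <= 14 /\ X (q + a.1) x) \/ (a.2 <= q /\ X (q - a.2) x).

Variables (n : R -> R) (bad : R -> R -> Prop).

(* Every walk with a single jump of size [g <= 2], at any time, is bad. *)
Fixpoint allbad (X : R -> R -> Prop) s : Prop :=
  (forall g p p' x y, inW p -> inW p' -> near g p p' -> g <= 2 ->
     X p x -> ends s p' y -> bad g (x + y)) /\
  (if s is a :: s' then allbad (push X a) s' else True).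

(* [bad g t] stands for "[t] is in no good interval shrunk by [g]" and [n t] for
   the number of good intervals to the left of [t].  The exchange relation
   [band_four] is what splits [n (x + y)] into two terms. *)
Record bands : Prop := Bands {
  band_mono : forall t t', t <= t' -> n t <= n t';
  band_four : forall x x' y y' g1 g2 g3 g4,
    inW x -> inW x' -> inW y -> inW y' ->
    0 <= g1 -> 0 <= g2 -> 0 <= g3 -> 0 <= g4 ->
    g1 + g2 + g3 + g4 <= 4 ->
    bad g1 (x + y) -> bad g2 (x' + y') -> bad g3 (x + y') -> bad g4 (x' + y) ->
    n (x + y) + n (x' + y') = n (x + y') + n (x' + y);
  band_near : forall t t' g, near g t t' -> g <= 2 -> bad g t -> bad 0 t' ->
    n t = n t';
  band_far : forall t t', 0 <= t -> t' <= 28 -> 6 < t' - t -> bad 0 t -> bad 0 t' ->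
    n t < n t' }.

Hypothesis nbad : bands.

Definition total (X : R -> R -> Prop) := forall p, inW p -> exists x, X p x.
Definition ranged (X : R -> R -> Prop) := forall p x, inW p -> X p x -> inW x.

Lemma ends_total s p : all okstep s -> inW p ->
  exists y, ends s p y.
Proof.
elim: s p => [|[u v] s IH] p /=; first by exists p.
move=> /andP[/and3P[/= u0 v0 uv] /IH{}IH] [p0 p1].
have [up|up] := le_or_lt u p.
  have [|y hy] := IH (p - u); first by split; arith.
  by exists y; left.
have [|y hy] := IH (p + v); first by split; arith.
by exists y; right; split => //; arith.
Qed.

Lemma ends_ranged s p y : all okstep s -> inW p ->
  ends s p y -> inW y.
Proof.
elim: s p => [|[u v] s IH] p /=; first by move=> _ ? ->.
move=> /andP[/and3P[/= u0 v0 uv] /IH{}IH] [p0 p1] [] [h]; apply: IH; split; arith.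
Qed.

Lemma push_total X a : okstep a -> total X -> total (push X a).
Proof.
case: a => u v /and3P[/= u0 v0 uv] hX q [q0 q1]; rewrite /push /=.
have [h|h] := le_or_lt (q + u) 14.
  have [|x hx] := hX (q + u); first by split; arith.
  by exists x; left.
have [|x hx] := hX (q - v); first by split; arith.
by exists x; right; split => //; arith.
Qed.

Lemma push_ranged X a : okstep a -> ranged X -> ranged (push X a).
Proof.
case: a => u v /and3P[/= u0 v0 uv] hX q x [q0 q1]; rewrite /push /= => -[] [h];
  apply: hX; split; arith.
Qed.

Definition lifted (X : R -> R -> Prop) s (k l : R -> R -> R) :=
  forall p p' x y, inW p -> inW p' -> near 2 p p' -> X p x -> ends s p' y ->
    n (x + y) = k p x + l p' y.

Section OneStage.
Variables (X : R -> R -> Prop) (s : seq (R * R)) (k l : R -> R -> R).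
Hypotheses (hs : all okstep s).
Hypotheses (tX : total X) (rX : ranged X) (P : lifted X s k l)
  (B : allbad X s).

Lemma hyb g p p' x y : inW p -> inW p' -> near g p p' -> g <= 2 ->
     X p x -> ends s p' y -> bad g (x + y).
Proof. by case: s B => [|? ?] [h _]; apply: h. Qed.

(* The midpoint of [p] and [p'] is within 2 of both. *)
Lemma lift_far t g p p' x y : inW p -> inW p' -> near g p p' ->
  0 <= t -> 0 <= g -> t + g <= 4 -> X p x -> ends s p' y -> bad t (x + y) ->
  n (x + y) = k p x + l p' y.
Proof.
move=> ip ip' [n1 n2] t0 g0 tg hx hy hb.
have im : inW ((p + p') / 2) by move: ip ip' => [? ?] [? ?]; split; arith.
have [xm hxm] := tX im; have [ym hym] := ends_total hs im.
have e1 : n (x + ym) = k p x + l ((p + p') / 2) ym by apply: P => //; split; arith.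
have e2 : n (xm + y) = k ((p + p') / 2) xm + l p' y by apply: P => //; split; arith.
have e3 : n (xm + ym) = k ((p + p') / 2) xm + l ((p + p') / 2) ym
  by apply: P => //; split; arith.
have := @band_four nbad x xm y ym t 0 (g / 2) (g / 2)
  (rX ip hx) (rX im hxm) (ends_ranged hs ip' hy) (ends_ranged hs im hym).
move=> h; have {h} : n (x + y) + n (xm + ym) = n (x + ym) + n (xm + y).
  apply: h; try arith; first done.
  - by apply: (hyb im im) => //; split; arith.
  - by apply: (hyb ip im) => //; [split|]; arith.
  - by apply: (hyb im ip') => //; [split|]; arith.
arith.
Qed.

(** Both sides equal [n (x + y)]. One of the jumps has size [g <= 2] and makes [x + y] bad with
    tolerance [g]; then [lift_far] applies to either route, as it allows a jump of up to [4 - g]. *)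
Lemma two_routes g1 g2 p1 p2 q1 q2 x y : inW p1 -> inW p2 -> inW q1 -> inW q2 ->
  near g1 p1 q1 -> near g2 p2 q2 -> 0 <= g1 -> 0 <= g2 -> g1 + g2 <= 4 ->
  X p1 x -> X p2 x -> ends s q1 y -> ends s q2 y ->
  k p1 x + l q1 y = k p2 x + l q2 y.
Proof.
move=> i1 i2 j1 j2 n1 n2 g10 g20 g4 h1 h2 e1 e2.
have [g|g] := le_or_lt g1 2.
  have b : bad g1 (x + y) by apply: (hyb i1 j1).
  rewrite -(@lift_far g1 g2 p2 q2 x y) // -(@lift_far g1 g1 p1 q1 x y) //; arith.
have b : bad g2 (x + y) by apply: (hyb i2 j2) => //; arith.
by rewrite -(@lift_far g2 g2 p2 q2 x y) // -?(@lift_far g2 g1 p1 q1 x y) //; arith.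
Qed.

(** A step down from [p] and a step up from [p - (u + v)] meet, so [y] is obtained both without a
    jump and with a jump of [u + v <= 4]. *)
Lemma shift_small u v p y : s = (u, v) :: behead s -> u + v <= 4 ->
  inW p -> u + v <= p -> ends (behead s) (p - u) y -> l p y = l (p - (u + v)) y.
Proof.
move=> es d4 [p0 p1] dp ey; have := hs; rewrite es => /andP[/and3P[/= u0 v0 uv] _].
have [x hx] : exists x, X p x by apply: tX.
have e1 : ends s p y by rewrite es; left; split => //; arith.
have e2 : ends s (p - (u + v)) y.
  by rewrite es; right; split; [arith|have -> : p - (u + v) + v = p - u by ring].
have h : k p x + l p y = k p x + l (p - (u + v)) y; last by arith.
have dp0 : inW (p - (u + v)) by split; arith.
clear es; by apply: (@two_routes 0 (u + v)) => //; bnd.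
Qed.

End OneStage.

Section Step.
Variables (X : R -> R -> Prop) (u v : R) (s : seq (R * R)) (k l : R -> R -> R).
Variable (dl : R).
Hypotheses (ok : okstep (u, v)) (hs' : all okstep s).
Hypotheses (tX : total X) (rX : ranged X) (P : lifted X ((u, v) :: s) k l)
  (B : allbad X ((u, v) :: s)).
Hypothesis Hd : forall p y, inW p -> u + v <= p -> ends s (p - u) y ->
  l p y - l (p - (u + v)) y = dl.

(** A position [q] after the demand comes from [q + u] or from [q - v]. These lie [u + v] apart, and
    the correction by [dl] makes both give the same value where both are available. *)
Definition lift_ends q y := if q + u <= 14 then l (q + u) y else l (q - v) y + dl.
Definition lift_starts q x :=
  if `[< q + u <= 14 /\ X (q + u) x >] then k (q + u) x else k (q - v) x - dl.

Let B' : allbad (push X (u, v)) s. Proof. by case: B. Qed.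

Lemma lift_ends_down q y : q + u <= 14 -> lift_ends q y = l (q + u) y.
Proof. by rewrite /lift_ends => ->. Qed.

Lemma lift_ends_up q y : inW q -> v <= q -> ends s q y ->
  lift_ends q y = l (q - v) y + dl.
Proof.
have /and3P[/= u0 v0 uv] := ok; move=> [q0 q1] vq e; rewrite /lift_ends; case: (lerP (q + u) 14) => // h.
rewrite -(@Hd (q + u) y); first by rewrite (_ : q + u - (u + v) = q - v); ring.
- by split; arith.
- arith.
- by rewrite addrK.
Qed.

Lemma lift_starts_down p x : inW p -> u <= p -> X p x ->
  lift_starts (p - u) x = k p x.
Proof.
have /and3P[/= u0 v0 uv] := ok; move=> [p0 p1] up hx; rewrite /lift_starts subrK; case: asboolP => // h.
by exfalso; apply: h.
Qed.

Lemma lift_starts_up p x : inW p -> p + v <= 14 -> X p x ->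
  lift_starts (p + v) x = k p x - dl.
Proof.
have /and3P[/= u0 v0 uv] := ok; move=> [p0 p1] pv hx; rewrite /lift_starts addrK; case: asboolP => // -[h hx'].
have iq : inW (p + v) by split; arith.
have [y hy] := ends_total hs' iq.
have e1 : n (x + y) = k (p + v + u) x + l (p + v + u) y.
  by apply: P; bnd; left; split; [arith|rewrite addrK].
have e2 : n (x + y) = k p x + l p y.
  by apply: P; bnd; right.
have : l (p + v + u) y - l (p + v + u - (u + v)) y = dl.
  by apply: Hd; [split; arith|arith|rewrite addrK].
rewrite (_ : p + v + u - (u + v) = p); last ring.
arith.
Qed.

(** If [q] and [q'] have predecessors on the same side of the demand, the old splitting applies. If
    not, some [Q] between them has predecessors on both sides, and the exchange relation with a walk
    through [Q] transfers the splitting. *)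
Lemma lifted_push : lifted (push X (u, v)) s lift_starts lift_ends.
Proof.
have /and3P[/= u0 v0 uv] := ok; move=> q q' x y [q0 q1] [q0' q1'] [n1 n2] hx hy.
have tX' := push_total ok tX; have rX' := push_ranged ok rX.
have iq : inW q by split. have iq' : inW q' by split.
(* The jumps to [Q] and from [Q] are together no longer than the one from [q] to [q'], so the four
   tolerances total at most 4. *)
have four Q x' y' : q <= Q <= q' \/ q' <= Q <= q -> push X (u, v) Q x' -> ends s Q y' ->
    n (x + y) + n (x' + y') = n (x + y') + n (x' + y).
  move=> hQ hx' hy'; have iQ : inW Q by split; case: hQ => /andP[]; arith.
  have gen g h : 0 <= g -> 0 <= h -> near g q Q -> near h Q q' -> g + h <= 2 ->
      n (x + y) + n (x' + y') = n (x + y') + n (x' + y).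
    move=> g0 h0 [gq1 gq2] [hq1 hq2] gh.
    have rng := rX' _ _ iq hx; have rng' := rX' _ _ iQ hx'.
    have rg := ends_ranged hs' iq' hy; have rg' := ends_ranged hs' iQ hy'.
    apply: (@band_four nbad _ _ _ _ (g + h) 0 g h); bnd.
    - by apply: (hyb B' iq iq'); bnd.
    - by apply: (hyb B' iQ iQ); bnd.
    - by apply: (hyb B' iq iQ); bnd.
    - by apply: (hyb B' iQ iq'); bnd.
  by case: hQ => /andP[a b]; [apply: (gen (Q - q) (q' - Q))|apply: (gen (q - Q) (Q - q'))]; bnd.
have up p z : p + v <= 14 -> ends s (p + v) z -> ends ((u, v) :: s) p z by right.
have dn p z : u <= p -> ends s (p - u) z -> ends ((u, v) :: s) p z by left.
case: (hx) => -[/= hq hxp].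
  have -> : lift_starts q x = k (q + u) x.
    by rewrite -{1}(addrK u q) lift_starts_down //; [split|]; arith.
  have [h|h] := le_or_lt (q' + u) 14.
    rewrite lift_ends_down //; apply: P => //; bnd.
    by apply: dn; [arith|rewrite addrK].
  rewrite lift_ends_up //; last arith.
  (* [14 - u] is the highest position that a step down can reach, from 14; a step up reaches it from
     [14 - (u + v)]. *)
  have [x' hx'] : exists x, X (14 - (u + v)) x by apply: tX; split; arith.
  have [y' hy'] : exists y, ends s (14 - u) y by apply: ends_total => //; split; arith.
  have f := @four (14 - u) x' y'.
  have {f} : n (x + y) + n (x' + y') = n (x + y') + n (x' + y).
    apply: f => //; first by left; apply/andP; split; arith.
    right; split => /=; first arith.
    by have -> : 14 - u - v = 14 - (u + v) by ring.
  have : l 14 y' - l (14 - (u + v)) y' = dl by apply: Hd => //; split; arith.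
  have : n (x + y') = k (q + u) x + l 14 y'.
    apply: P => //; bnd.
    by apply: dn => //; arith.
  have : n (x' + y') = k (14 - (u + v)) x' + l (14 - (u + v)) y'.
    apply: P => //; bnd.
    by apply: up; [arith|rewrite (_ : _ + v = 14 - u) //; ring].
  have : n (x' + y) = k (14 - (u + v)) x' + l (q' - v) y.
    apply: P => //; bnd.
    by apply: up; [arith|rewrite subrK].
  arith.
have -> : lift_starts q x = k (q - v) x - dl.
  by rewrite -{1}(subrK v q) lift_starts_up //; [split|]; arith.
have [h|h] := le_or_lt v q'.
  rewrite lift_ends_up //.
  have : n (x + y) = k (q - v) x + l (q' - v) y; last by arith.
  apply: P => //; bnd.
  by apply: up; [arith|rewrite subrK].
rewrite lift_ends_down //; last arith.
(* Likewise [v] is the lowest position that a step up can reach, from 0; a step down reaches it from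
   [u + v]. *)
have [x' hx'] : exists x, X (u + v) x by apply: tX; split; arith.
have [y' hy'] : exists y, ends s v y by apply: ends_total => //; split; arith.
have f := @four v x' y'.
have {f} : n (x + y) + n (x' + y') = n (x + y') + n (x' + y).
  apply: f => //; first by right; apply/andP; split; arith.
  left; split => /=; first arith.
  by have -> : v + u = u + v by ring.
have : l (u + v) y' - l (u + v - (u + v)) y' = dl.
  by apply: Hd => //; [split; arith|rewrite (_ : u + v - u = v) //; ring].
rewrite subrr.
have : n (x + y') = k (q - v) x + l 0 y'.
  apply: P => //; bnd.
  by apply: up; [arith|rewrite add0r].
have : n (x' + y') = k (u + v) x' + l (u + v) y'.
  apply: P => //; bnd.
  by apply: dn; [arith|rewrite (_ : u + v - u = v) //; ring].
have : n (x' + y) = k (u + v) x' + l (q' + u) y.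
  apply: P => //; bnd.
  by apply: dn; [arith|rewrite addrK].
arith.
Qed.

End Step.
Lemma ends_down a s p q y : a.1 <= p -> q = p - a.1 -> ends s q y -> ends (a :: s) p y.
Proof. by case: a => u v /= h -> ?; left. Qed.

Lemma ends_up a s p q y : p + a.2 <= 14 -> q = p + a.2 -> ends s q y -> ends (a :: s) p y.
Proof. by case: a => u v /= h -> ?; right. Qed.

(** As [p] ranges over [[u + v, 14]], shorter than 4, two moves of at most 2 lead from [p] to 14.
    For each move, the exchange relation for starts on the two sides of the demand and ends [y],
    [y'] cancels all values of [k]. *)
Lemma shift_big X u v s k l : okstep (u, v) -> all okstep s -> total X -> ranged X ->
    lifted X ((u, v) :: s) k l -> allbad X ((u, v) :: s) -> 10 < u + v ->
  exists dl, forall p y, inW p -> u + v <= p -> ends s (p - u) y ->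
    l p y - l (p - (u + v)) y = dl.
Proof.
move=> ok hs tX rX P B big; have /and3P[/= u0 v0 uv] := ok.
have hS : all okstep ((u, v) :: s) by rewrite /= hs andbT.
have dn p z : u <= p -> ends s (p - u) z -> ends ((u, v) :: s) p z by left.
have up p z : u + v <= p -> p <= 14 -> ends s (p - u) z ->
    ends ((u, v) :: s) (p - (u + v)) z.
  by move=> h1 h2 h; right; split; [arith|rewrite (_ : _ + v = p - u) //; ring].
have loc p p' y y' : inW p -> inW p' -> near 2 p p' -> u + v <= p -> u + v <= p' ->
    ends s (p - u) y -> ends s (p' - u) y' ->
    l p y - l (p - (u + v)) y = l p' y' - l (p' - (u + v)) y'.
  move=> [p0 p1] [p0' p1'] [n1 n2] dp dp' hy hy'.
  have i1 : inW (p - (u + v)) by split; arith.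
  have i2 : inW (p' - (u + v)) by split; arith.
  have [x hx] : exists x, X p x by apply: tX.
  have [x2 hx2] := tX _ i1.
  have ey := dn p y ltac:(arith) hy; have ey' := dn p' y' ltac:(arith) hy'.
  have fy := up p y dp p1 hy; have fy' := up p' y' dp' p1' hy'.
  have e1 : n (x + y) = k p x + l p y by apply: P; bnd.
  have e2 : n (x + y') = k p x + l p' y' by apply: P; bnd.
  have e3 : n (x2 + y) = k (p - (u + v)) x2 + l (p - (u + v)) y by apply: P; bnd.
  have e4 : n (x2 + y') = k (p - (u + v)) x2 + l (p' - (u + v)) y' by apply: P; bnd.
  have ix := rX _ _ (conj p0 p1) hx; have ix2 := rX _ _ i1 hx2.
  have iy := ends_ranged hS (conj p0 p1) ey.
  have iy' := ends_ranged hS (conj p0' p1') ey'.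
  have gen g : 0 <= g -> g <= 2 -> near g p p' ->
      n (x + y) + n (x2 + y') = n (x + y') + n (x2 + y).
    move=> g0 g2 [m1 m2]; apply: (@band_four nbad _ _ _ _ 0 g g 0); bnd.
    - by apply: (hyb B (p := p) (p' := p)); bnd.
    - by apply: (hyb B (p := p - (u + v)) (p' := p' - (u + v))); bnd.
    - by apply: (hyb B (p := p) (p' := p')); bnd.
    - by apply: (hyb B (p := p - (u + v)) (p' := p - (u + v))); bnd.
  have [h|h] := le_or_lt p p'.
    have := gen (p' - p) ltac:(arith) ltac:(arith) ltac:(split; arith); arith.
  have := gen (p - p') ltac:(arith) ltac:(arith) ltac:(split; arith); arith.
have [y0 hy0] : exists y, ends s (14 - u) y by apply: ends_total => //; split; arith.
exists (l 14 y0 - l (14 - (u + v)) y0) => p y [p0 p1] dp hy.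
have [y1 hy1] : exists y, ends s ((p + 14) / 2 - u) y
  by apply: ends_total => //; split; arith.
by rewrite (@loc p ((p + 14) / 2) y y1) ?(@loc ((p + 14) / 2) 14 y1 y0) //; bnd.
Qed.

Definition stage X s k l :=
  [/\ total X, ranged X, lifted X s k l & allbad X s].

(* How the lifts change over a demand [a]: [dl] is the difference of [l] between
   the two sides of [a]. *)
Definition carried X a s (k l k' l' : R -> R -> R) dl :=
  [/\ forall p x, inW p -> a.1 <= p -> X p x -> k' (p - a.1) x = k p x,
      forall p x, inW p -> p + a.2 <= 14 -> X p x -> k' (p + a.2) x = k p x - dl,
      forall q y, q + a.1 <= 14 -> l' q y = l (q + a.1) y &
      forall q y, inW q -> a.2 <= q -> ends s q y -> l' q y = l (q - a.2) y + dl].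

Lemma stage_push X a s k l dl : okstep a -> all okstep s -> stage X (a :: s) k l ->
    (forall p y, inW p -> a.1 + a.2 <= p -> ends s (p - a.1) y ->
      l p y - l (p - (a.1 + a.2)) y = dl) ->
  exists k' l', stage (push X a) s k' l' /\ carried X a s k l k' l' dl.
Proof.
case: a => u v ok hs [tX rX P B] Hd.
exists (lift_starts X u v k dl), (lift_ends u v l dl); split; split.
- exact: push_total.
- exact: push_ranged.
- exact: (lifted_push ok hs tX rX P B Hd).
- by case: B.
- by move=> p x; apply: lift_starts_down.
- by move=> p x; apply: (lift_starts_up ok hs P Hd).
- by move=> q y; apply: lift_ends_down.
- by move=> q y; apply: (lift_ends_up ok Hd).
Qed.

Lemma stage_small X a s k l : small a -> all okstep s -> stage X (a :: s) k l ->
  exists k' l', stage (push X a) s k' l' /\ carried X a s k l k' l' 0.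
Proof.
move=> /andP[ok d4] hs st; apply: stage_push => // p y ip dp hy.
have hS : all okstep (a :: s) by rewrite /= ok.
case: st => tX rX P B; apply/eqP; rewrite subr_eq0; apply/eqP.
apply: (shift_small hS tX rX P B) => //=; last arith.
by case: (a).
Qed.

(* A drop of [k] across the last big demand, [d]. *)
Definition gap (X k : R -> R -> _) d :=
  forall q, 0 <= q -> q <= 14 - d -> exists x, [/\ X q x : Prop, X (q + d) x & k (q + d) x < k q x :> R].

(** All differences of [l] across a big demand are equal, so one increase makes them all positive. A
    start that reaches [q + a.1] can go on to [q] and to [q + (a.1 + a.2)], where its values of [k']
    differ by that constant. *)
Lemma stage_big X a s k l : big a -> all okstep s -> stage X (a :: s) k l ->
    (exists r y, [/\ 0 <= r, r <= 14 - (a.1 + a.2), ends s (r + a.2) y &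
       l r y < l (r + (a.1 + a.2)) y]) ->
  exists k' l', stage (push X a) s k' l' /\ gap (push X a) k' (a.1 + a.2).
Proof.
move=> /andP[ok d10] hs st [r [y [r0 r1 hy ll]]]; have /and3P[u0 v0 uv] := ok.
have [dl Hd] : exists dl, forall p y, inW p -> a.1 + a.2 <= p -> ends s (p - a.1) y ->
    l p y - l (p - (a.1 + a.2)) y = dl.
  by case: st => tX rX P B; apply: (@shift_big X a.1 a.2 s k l); rewrite -?surjective_pairing.
have dl0 : 0 < dl.
  rewrite -(Hd (r + (a.1 + a.2)) y); first by rewrite addrK subr_gt0.
  - by split; arith.
  - arith.
  - by rewrite (_ : _ - _ = r + a.2) //; ring.
have [k' [l' [st' [c1 c2 _ _]]]] := stage_push ok hs st Hd.
exists k', l'; split=> // q q0 q1.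
have ip : inW (q + a.1) by split; arith.
case: st => tX _ _ _; have [x hx] := tX _ ip.
have e1 := c1 _ _ ip ltac:(arith) hx; have e2 := c2 _ _ ip ltac:(arith) hx.
move: e1 e2; rewrite addrK -addrA => e1 e2.
exists x; split.
- by left; split => //; arith.
- right; split; first arith.
  by rewrite (_ : _ - _ = q + a.1) //; ring.
- by rewrite e1 e2; arith.
Qed.

(** The comparison is made after [a]. The start with a drop from 0 to [d] moves on to [a.2] and
    [d - a.1], while [y] is reached from [r] and [r + (b.1 + b.2)]. The two jumps total at most 4,
    so [two_routes] turns the drop of [k1] into a rise of [l1]. *)
Lemma drop_after_wider X a b s k l k1 l1 d : small a -> big b -> all okstep s ->
    10 <= d -> d <= 14 -> stage X (a :: b :: s) k l -> gap X k d ->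
    stage (push X a) (b :: s) k1 l1 -> carried X a (b :: s) k l k1 l1 0 ->
    b.1 + b.2 <= d ->
  exists r y, [/\ 0 <= r, r <= 14 - (b.1 + b.2), ends s (r + b.2) y &
    l1 r y < l1 (r + (b.1 + b.2)) y].
Proof.
move=> sa sb hs d10 d14 st gp st1 [c1 c2 c3 c4] e.
have [/andP[oka da] /andP[okb db]] := (sa, sb).
have /and3P[ua va uva] := oka; have /and3P[ub vb uvb] := okb.
have hs1 : all okstep (b :: s) by rewrite /= okb.
case: st st1 => [tX rX P B] [tX1 rX1 P1 B1].
(* [r] is as close to [a.2] as possible while [r + (b.1 + b.2)] stays in the strip. *)
have [r rE] : exists r, r = Num.min a.2 (14 - (b.1 + b.2)) by eexists.
have [r0 rv rz] : [/\ 0 <= r, r <= a.2 & r <= 14 - (b.1 + b.2)].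
  by rewrite rE; split; [rewrite le_min; apply/andP; split; arith| |]; rewrite ge_min lexx ?orbT.
have rc : r = a.2 \/ r = 14 - (b.1 + b.2).
  by rewrite rE /Num.min; case: ifP => _; [left|right].
have [y hy] : exists y, ends s (r + b.2) y by apply: ends_total => //; split; arith.
exists r, y; split => //.
have [x [x1 x2 kk]] := gp 0 ltac:(arith) ltac:(arith).
rewrite add0r in x2 kk.
have X1 : push X a a.2 x by right; split => //; rewrite subrr.
have X2 : push X a (d - a.1) x by left; split; [arith|rewrite subrK].
have k1E := c2 0 x ltac:(split; arith) ltac:(arith) x1.
have k2E := c1 d x ltac:(split; arith) ltac:(arith) x2.
have Y1 : ends (b :: s) r y by apply: ends_up hy; arith.
have Y2 : ends (b :: s) (r + (b.1 + b.2)) y by apply: ends_down hy; arith.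
have /(_ (a.2 - r) `|r + (b.1 + b.2) - (d - a.1)|) := two_routes hs1 tX1 rX1 P1 B1.
move=> /(_ a.2 (d - a.1) r (r + (b.1 + b.2)) x y) h.
have {h} h : k1 a.2 x + l1 r y = k1 (d - a.1) x + l1 (r + (b.1 + b.2)) y.
  have [nn|nn] := le_or_lt 0 (r + (b.1 + b.2) - (d - a.1)).
    by rewrite ger0_norm // in h; apply: h; bnd; case: rc => ?; arith.
  by rewrite ltr0_norm // in h; apply: h; bnd; case: rc => ?; arith.
by rewrite add0r in k1E; arith.
Qed.

(** The comparison is made before [a]: the positions 0 and [b.1 + b.2] after [a] are pulled back to
    [a.1] and [b.1 + b.2 - a.2], and the drop of [k] is taken at [q], as close to [a.1] as the strip
    allows. *)
Lemma drop_after_narrower X a b s k l k1 l1 d : small a -> big b -> all okstep s ->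
    10 <= d -> d <= 14 -> stage X (a :: b :: s) k l -> gap X k d ->
    stage (push X a) (b :: s) k1 l1 -> carried X a (b :: s) k l k1 l1 0 ->
    d < b.1 + b.2 ->
  exists r y, [/\ 0 <= r, r <= 14 - (b.1 + b.2), ends s (r + b.2) y &
    l1 r y < l1 (r + (b.1 + b.2)) y].
Proof.
move=> sa sb hs d10 d14 st gp st1 [c1 c2 c3 c4] e.
have [/andP[oka da] /andP[okb db]] := (sa, sb).
have /and3P[ua va uva] := oka; have /and3P[ub vb uvb] := okb.
have hs2 : all okstep (a :: b :: s) by rewrite /= oka okb.
case: st st1 => [tX rX P B] [tX1 rX1 P1 B1].
have [q qE] : exists q, q = Num.min a.1 (14 - d) by eexists.
have [q0 qu qz] : [/\ 0 <= q, q <= a.1 & q <= 14 - d].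
  by rewrite qE; split; [rewrite le_min; apply/andP; split; arith| |]; rewrite ge_min lexx ?orbT.
have qc : q = a.1 \/ q = 14 - d.
  by rewrite qE /Num.min; case: ifP => _; [left|right].
have [y hy] : exists y, ends s b.2 y by apply: ends_total => //; split; arith.
exists 0, y; rewrite !add0r; split => //; first arith.
have [x [x1 x2 kk]] := gp q ltac:(arith) ltac:(arith).
have Z1 : ends (b :: s) 0 y by apply: ends_up hy; arith.
have Z2 : ends (b :: s) (b.1 + b.2) y by apply: ends_down hy; arith.
have Y1 : ends (a :: b :: s) a.1 y by apply: ends_down Z1; arith.
have Y2 : ends (a :: b :: s) (b.1 + b.2 - a.2) y by apply: ends_up Z2; arith.
have E1 := c3 0 y ltac:(arith); rewrite add0r in E1.
have E2 := c4 (b.1 + b.2) y ltac:(split; arith) ltac:(arith) Z2.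
have /(_ (a.1 - q) `|q + d - (b.1 + b.2 - a.2)|) := two_routes hs2 tX rX P B.
move=> /(_ q (q + d) a.1 (b.1 + b.2 - a.2) x y) h.
have {h} h : k q x + l a.1 y = k (q + d) x + l (b.1 + b.2 - a.2) y.
  have [nn|nn] := le_or_lt 0 (q + d - (b.1 + b.2 - a.2)).
    by rewrite ger0_norm // in h; apply: h; bnd; case: qc => ?; arith.
  by rewrite ltr0_norm // in h; apply: h; bnd; case: qc => ?; arith.
arith.
Qed.

Lemma stage_small_big X a b s k l d : small a -> big b -> all okstep s ->
    10 <= d -> d <= 14 -> stage X (a :: b :: s) k l -> gap X k d ->
  exists k' l', stage (push (push X a) b) s k' l' /\
    gap (push (push X a) b) k' (b.1 + b.2).
Proof.
move=> sa sb hs d10 d14 st gp; have /andP[okb _] := sb.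
have hs1 : all okstep (b :: s) by rewrite /= okb.
have [k1 [l1 [st1 ca]]] := stage_small sa hs1 st.
apply: (stage_big sb hs st1); have [e|e] := le_or_lt (b.1 + b.2) d.
  exact: (drop_after_wider sa sb hs d10 d14 st gp st1 ca).
exact: (drop_after_narrower sa sb hs d10 d14 st gp st1 ca).
Qed.

(** With no demand left, the end is [p] itself. Ends at most 2 apart have the same [n], hence the
    same [l], and 7 moves of at most 2 lead to 0. *)
Lemma lifted_nil_const X k l : stage X [::] k l -> forall p, inW p -> l p p = l 0 0.
Proof.
move=> [tX rX P B].
have loc p p' : inW p -> inW p' -> 0 <= p - p' -> p - p' <= 2 -> l p p = l p' p'.
  move=> ip ip' h1 h2; have [x hx] := tX _ ip'.
  have e1 : n (x + p) = k p' x + l p p by apply: P; bnd.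
  have e2 : n (x + p') = k p' x + l p' p' by apply: P; bnd.
  have : n (x + p) = n (x + p'); last arith.
  apply: (@band_near nbad _ _ (p - p')); bnd.
  - by apply: (hyb B (p := p') (p' := p)); bnd.
  - by apply: (hyb B (p := p') (p' := p')); bnd.
have H (m : nat) p : inW p -> p <= 2 * m%:R -> l p p = l 0 0.
  elim: m p => [|m IH] p [p0 p1]; first by rewrite mulr0 => p2; rewrite (_ : p = 0) //; arith.
  rewrite -natr1 => p2; have [h|h] := lerP p 2; first by apply: loc; bnd.
  by rewrite (loc p (p - 2)) ?IH //; bnd.
by move=> p ip; apply: (H 7%N) => //; case: ip; arith.
Qed.

(** The drop from 0 to [d] is carried to the ends [a.2] and [d - a.1], where [l] is constant. So [n]
    would decrease although the sum increases, as [a.1 + a.2 < d]. *)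
Lemma stage_last X a k l d : small a -> 10 <= d -> d <= 14 ->
  stage X [:: a] k l -> gap X k d -> False.
Proof.
move=> sa d10 d14 st gp; have /andP[/and3P[u0 v0 uv] d4] := sa.
have [k1 [l1 [st1 [c1 c2 _ _]]]] := stage_small (s := [::]) sa isT st.
have [x [x1 x2]] := gp 0 ltac:(arith) ltac:(arith); rewrite add0r in x2 * => kk.
have lc := lifted_nil_const st1; case: st1 => tX1 rX1 P1 B1.
have e1 : n (x + a.2) = k1 a.2 x + l1 a.2 a.2.
  by apply: P1; bnd; right; rewrite subrr.
have e2 : n (x + (d - a.1)) = k1 (d - a.1) x + l1 (d - a.1) (d - a.1).
  by apply: P1; bnd; left; rewrite subrK; split => //; arith.
have k1E := c2 0 x ltac:(split; arith) ltac:(arith) x1.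
have k2E := c1 d x ltac:(split; arith) ltac:(arith) x2.
have := @band_mono nbad (x + a.2) (x + (d - a.1)).
rewrite !lc in e1 e2; bnd.
rewrite add0r in k1E; move=> /(_ ltac:(arith)); arith.
Qed.

Definition steps (bs : seq ((R * R) * (R * R))) e :=
  foldr (fun ab s => ab.1 :: ab.2 :: s) [:: e] bs.

Lemma steps_ok bs e : all (fun ab => small ab.1 && big ab.2) bs -> small e ->
  all okstep (steps bs e).
Proof.
move=> + /andP[oke _]; elim: bs => [|[a b] bs IH] /=; first by rewrite oke.
by move=> /andP[/andP[/andP[-> _] /andP[-> _]] /IH].
Qed.

Lemma stage_steps X bs e k l d : all (fun ab => small ab.1 && big ab.2) bs -> small e ->
  10 <= d -> d <= 14 -> stage X (steps bs e) k l -> gap X k d -> False.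
Proof.
move=> + se; elim: bs X k l d => [|[a b] bs IH] X k l d /=.
  by move=> _ d10 d14; apply: stage_last.
move=> /andP[/andP[/= sa sb] hbs] d10 d14 st gp.
have [k' [l' [st' gp']]] := stage_small_big sa sb (steps_ok hbs se) d10 d14 st gp.
case/andP: sb => /and3P[? ? ?] ?.
by apply: IH st' gp' => //; arith.
Qed.

Theorem not_allbad bs e : all (fun ab => small ab.1 && big ab.2) bs -> small e ->
  ~ allbad (fun p x => x = p) (steps bs e).
Proof.
move=> hbs se B.
have t0 : total (fun p x : R => x = p) by move=> p _; exists p.
have r0 : ranged (fun p x : R => x = p) by move=> p x ? ->.
(* Initially each position is its own start, so the splitting is [0 + n (p + y)]. *)
have st : stage (fun p x => x = p) (steps bs e) (fun _ _ => 0) (fun p y => n (p + y)).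
  split=> // p p' x y ip ip' [n1 n2] -> hy; rewrite add0r.
  have b0 : bad 0 (p' + y) by apply: (hyb B (p := p') (p' := p')); bnd.
  have [h|h] := le_or_lt p p'.
    apply: (@band_near nbad _ _ (p' - p)); bnd.
    by apply: (hyb B (p := p) (p' := p')); bnd.
  apply: (@band_near nbad _ _ (p - p')); bnd.
  by apply: (hyb B (p := p) (p' := p')); bnd.
case: bs hbs B st => [_|[a b] bs /=/andP[/andP[/= sa sb] hbs]] B st.
  (* With [e] alone, the starts 0 and 14 would give equal values of [n] at sums more than 6
     apart. *)
  have /andP[/and3P[u0 v0 uv] d4] := se.
  have [k1 [l1 [st1 [c1 c2 _ _]]]] := stage_small (s := [::]) se isT st.
  have lc := lifted_nil_const st1; case: st1 => tX1 rX1 P1 B1.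
  have m1 : push (fun p x : R => x = p) e e.2 0 by right; rewrite subrr.
  have m2 : push (fun p x : R => x = p) e (14 - e.1) 14 by left; rewrite subrK.
  have i1 : inW e.2 by split; arith.
  have i2 : inW (14 - e.1) by split; arith.
  have e1 : n (0 + e.2) = k1 e.2 0 + l1 e.2 e.2 by apply: P1; bnd.
  have e2 : n (14 + (14 - e.1)) = k1 (14 - e.1) 14 + l1 (14 - e.1) (14 - e.1)
    by apply: P1; bnd.
  have k1E := c2 0 0 ltac:(split; arith) ltac:(arith) erefl.
  have k2E := c1 14 14 ltac:(split; arith) ltac:(arith) erefl.
  have : n (0 + e.2) < n (14 + (14 - e.1)).
    apply: (@band_far nbad); bnd.
    - by apply: (hyb B1 (p := e.2) (p' := e.2)); bnd.
    - by apply: (hyb B1 (p := 14 - e.1) (p' := 14 - e.1)); bnd.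
  rewrite !lc // in e1 e2; rewrite add0r in k1E; arith.
have hs := steps_ok hbs se.
have [/andP[oka da] /andP[okb db]] := (sa, sb).
have /and3P[ua va uva] := oka; have /and3P[ub vb uvb] := okb.
have hs1 : all okstep (b :: steps bs e) by rewrite /= okb.
have [k1 [l1 [st1 [c1 c2 _ _]]]] := stage_small sa hs1 st.
have [|k' [l' [st' gp']]] := stage_big sb hs st1; last first.
  by apply: (stage_steps hbs se _ _ st' gp'); arith.
have [y hy] : exists y, ends (steps bs e) b.2 y by apply: ends_total => //; split; arith.
(* The first rise: two starts with [k = 0] lead through [a] to the two sides of [b]. Their sums with
   [y] are more than 6 apart, so [l1] must increase. *)
exists 0, y; rewrite !add0r; split => //; first arith.
case: st1 => tX1 rX1 P1 B1.
have Z1 : ends (b :: steps bs e) 0 y by apply: ends_up hy; arith.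
have Z2 : ends (b :: steps bs e) (b.1 + b.2) y by apply: ends_down hy; arith.
have m1 : push (fun p x : R => x = p) a 0 a.1 by left; rewrite add0r; split => //; arith.
have m2 : push (fun p x : R => x = p) a (b.1 + b.2) (b.1 + b.2 - a.2).
  by right; split => //; arith.
have i1 : inW (0 : R) by split; arith.
have i2 : inW (b.1 + b.2) by split; arith.
have e1 : n (a.1 + y) = k1 0 a.1 + l1 0 y by apply: P1; bnd.
have e2 : n (b.1 + b.2 - a.2 + y) = k1 (b.1 + b.2) (b.1 + b.2 - a.2) + l1 (b.1 + b.2) y.
  by apply: P1; bnd.
have k1E := c1 a.1 a.1 ltac:(split; arith) ltac:(arith) erefl.
have k2E := c2 (b.1 + b.2 - a.2) _ ltac:(split; arith) ltac:(arith) erefl.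
have : n (a.1 + y) < n (b.1 + b.2 - a.2 + y).
  have [y0 y1] : inW y := ends_ranged hs1 i1 Z1.
  apply: (@band_far nbad); bnd.
  - by apply: (hyb B1 (p := 0) (p' := 0)); bnd.
  - by apply: (hyb B1 (p := b.1 + b.2) (p' := b.1 + b.2)); bnd.
rewrite subrr in k1E; rewrite subrK in k2E; arith.
Qed.

End Strip.
Arguments ends {R}.
Arguments push {R}.
Arguments okstep {R}.
Arguments small {R}.
Arguments big {R}.
Arguments total {R}.
Arguments ranged {R}.
Arguments allbad {R}.
Arguments bands {R}.
Arguments steps {R}.

(** * Choices of parts under rotation, merging and reversal *)

Section Core.
Variable R : realFieldType.
Implicit Types (x y z g h u v : R) (zs : seq R) (a b c : R * R) (s l : seq (R * R)).

Definition sum zs := \sum_(z <- zs) z.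

Lemma sum_nil : sum [::] = 0. Proof. exact: big_nil. Qed.
Lemma sum_cons z zs : sum (z :: zs) = z + sum zs. Proof. exact: big_cons. Qed.
Lemma sum_cat zs zs' : sum (zs ++ zs') = sum zs + sum zs'. Proof. exact: big_cat. Qed.
Lemma sum_rcons zs z : sum (rcons zs z) = sum zs + z.
Proof. by rewrite -cats1 sum_cat sum_cons sum_nil addr0. Qed.

Fixpoint choice s zs :=
  match s, zs with
  | [::], [::] => True
  | a :: s, z :: zs => (z = a.2 \/ z = - a.1) /\ choice s zs
  | _, _ => False
  end.

Lemma choice_size s zs : choice s zs -> size zs = size s.
Proof. by elim: s zs => [|a s IH] [|z zs] //= [_ /IH ->]. Qed.

Lemma choice_cat s s' zs zs' : choice s zs -> choice s' zs' ->
  choice (s ++ s') (zs ++ zs').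
Proof. by elim: s zs => [|a s IH] [|z zs] //= [? ?] ?; split=> //; apply: IH. Qed.

Lemma choice_rcons s a zs z : choice s zs -> z = a.2 \/ z = - a.1 ->
  choice (rcons s a) (rcons zs z).
Proof. by move=> cs h; rewrite -!cats1; apply: choice_cat => //=; split. Qed.

Lemma choice_rconsP s a zs : choice (rcons s a) zs ->
  exists zs' z, [/\ zs = rcons zs' z, choice s zs' & z = a.2 \/ z = - a.1].
Proof.
elim: s zs => [|b s IH] [|z zs] //=.
  by case: zs => [|? ?] [] //= h _; exists [::], z.
by move=> [h /IH [zs' [z' [-> ? ?]]]]; exists (z :: zs'), z'.
Qed.

Definition sol l := exists2 zs, choice l zs &
  forall k, - 19 <= 2 * sum (take k zs) - sum zs <= 19.

Definition swap a := (a.2, a.1).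

Lemma take_minn_size (T : Type) k (t : seq T) : take (minn k (size t)) t = take k t.
Proof.
by have [//|hk] := leqP k (size t); rewrite take_size take_oversize // ltnW.
Qed.

(** The value [z] of the moved demand changes sign. For a prefix sum [P] and the sum [T] of the
    other values, [2 (P - z) - (T - z) = 2 P - (T + z)]. *)
Lemma sol_rot a l : sol (rcons l (swap a)) -> sol (a :: l).
Proof.
move=> [zs' /choice_rconsP[zs [z [-> cz hz]]] h]; exists (- z :: zs).
  by split => //=; case: hz => -> /=; [right|left; rewrite opprK].
(* The empty prefix of the new sequence gives the negative of the value at the prefix [zs] of the
   old one. *)
have h1 := h (size zs).
rewrite -cats1 take_size_cat // cats1 sum_rcons in h1.
case=> [|k]; rewrite /= ?sum_nil sum_cons ?sum_cons; first by arith.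
have := h (minn k (size zs)); rewrite sum_rcons -cats1 takel_cat ?geq_minr //.
rewrite take_minn_size; arith.
Qed.

Lemma sol_rots l l' : sol (l' ++ map swap l) -> sol (l ++ l').
Proof.
elim: l l' => [|a l IH] l' /=; first by rewrite cats0.
rewrite -cat_rcons => /IH h; apply: sol_rot.
by rewrite -cats1 -catA cats1.
Qed.

(** Both demands take the direction of the merged step, so the additional prefix sum lies between
    its two neighbours. *)
Lemma sol_merge a b l : 0 <= a.1 -> 0 <= a.2 -> 0 <= b.1 -> 0 <= b.2 ->
  sol ((a.1 + b.1, a.2 + b.2) :: l) -> sol (a :: b :: l).
Proof.
move=> a1 a2 b1 b2 [[|z zs] // /= [hz cz] h].
have h0 := h 0%N; rewrite /= sum_nil sum_cons in h0.
have [w [w' [zE hw hw' hh]]] : exists w w', [/\ z = w + w', w = a.2 \/ w = - a.1,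
    w' = b.2 \/ w' = - b.1 & (0 <= w /\ 0 <= w') \/ (w <= 0 /\ w' <= 0)].
  case: hz => -> /=.
    by exists a.2, b.2; split; [|left|left|left].
  by exists (- a.1), (- b.1); split; [ring|right|right|right; rewrite !oppr_le0].
exists (w :: w' :: zs); first by split; [|split].
have h1 := h 1%N; rewrite /= take0 !sum_cons sum_nil in h1.
case=> [|[|k]] /=; rewrite ?take0 ?sum_nil !sum_cons ?sum_nil; first by arith.
  by case: hh => -[? ?]; arith.
by have := h k.+1; rewrite /= !sum_cons; arith.
Qed.

Lemma sol_swap l : sol (map swap l) -> sol l.
Proof.
move=> [zs cz h]; exists (map -%R zs).
  elim: l zs cz {h} => [|a l IH] [|z zs] //= [hz /IH ?]; split=> //.
  by case: hz => ->; [right|left; rewrite opprK].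
have sumN t : sum (map -%R t) = - sum t.
  by elim: t => [|z t IH]; rewrite /= ?sum_nil ?oppr0 // !sum_cons IH opprD.
by move=> k; rewrite -map_take !sumN; have := h k; arith.
Qed.

Lemma sol_drop0 l : sol (rcons l (0, 0)) -> sol l.
Proof.
move=> [zs' /choice_rconsP[zs [z [-> cz hz]]] h]; exists zs => // k.
have z0 : z = 0 by case: hz => -> //=; rewrite oppr0.
have := h (minn k (size zs)); rewrite sum_rcons z0 -cats1 takel_cat ?geq_minr //.
rewrite take_minn_size; arith.
Qed.

End Core.
Arguments sum {R}.
Arguments choice {R}.
Arguments sol {R}.
Arguments swap {R}.

(** * From walks with one jump to choices of parts *)

Section Hybrid.
Variable R : realFieldType.
Implicit Types (p x y z g h u v : R) (zs : seq R) (a b c : R * R) (s l : seq (R * R)).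

Definition reach s := foldl push (fun p x => x = p) s.

Lemma reach_choice s p x : all okstep s -> inW p -> reach s p x -> exists zs,
  [/\ choice s zs, p = x + sum zs & forall k, inW (x + sum (take k zs))].
Proof.
elim/last_ind: s p => [|s a IH] p.
  move=> _ ip xp; exists [::]; have {xp} -> : x = p by exact: xp.
  by split=> // [|k]; rewrite sum_nil addr0.
rewrite all_rcons /reach foldl_rcons => /andP[/and3P[a1 a2 a3] hs] [p0 p1].
have step q z : inW q -> reach s q x -> p = q + z -> (z = a.2 \/ z = - a.1) ->
    exists zs, [/\ choice (rcons s a) zs, p = x + sum zs &
      forall k, inW (x + sum (take k zs))].
  move=> iq hq pE hz; have [zs [cz qE hk]] := IH q hs iq hq.
  exists (rcons zs z); split; first exact: choice_rcons.
    by rewrite sum_rcons addrA -qE.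
  move=> k; have [hle|hlt] := leqP k (size zs).
    by rewrite -cats1 takel_cat.
  by rewrite take_oversize ?size_rcons // sum_rcons addrA -qE -pE.
move=> [] [h hq].
  by apply: (step _ (- a.1) _ hq); [split; arith|rewrite addrK|right].
by apply: (step _ a.2 _ hq); [split; arith|rewrite subrK|left].
Qed.

Lemma ends_choice s p y : all okstep s -> inW p -> ends s p y -> exists zs,
  [/\ choice s zs, y = p + sum zs & forall k, inW (p + sum (take k zs))].
Proof.
elim: s p => [|[u v] s IH] p.
  move=> _ ip yp; exists [::]; have {yp} -> : y = p by exact: yp.
  by split=> // [|k]; rewrite sum_nil addr0.
move=> /andP[/and3P[/= a1 a2 a3] hs] [p0 p1].
have step q z : inW q -> ends s q y -> q = p + z -> (z = v \/ z = - u) ->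
    exists zs, [/\ choice ((u, v) :: s) zs, y = p + sum zs &
      forall k, inW (p + sum (take k zs))].
  move=> iq hq pE hz; have [zs [cz qE hk]] := IH q hs iq hq.
  exists (z :: zs); split; first by split.
    by rewrite sum_cons addrA -pE.
  case=> [|k] /=; first by rewrite sum_nil addr0; split.
  by rewrite sum_cons addrA -pE.
move=> [] [h hq].
  by apply: (step _ (- u) _ hq); [split; arith| |right].
by apply: (step _ v _ hq); [split; arith| |left].
Qed.

Lemma not_allbadP (bad : R -> R -> Prop) X s : ~ allbad bad X s ->
  exists s1 s2 g p p' x y, [/\ s = s1 ++ s2, inW p /\ inW p', near g p p' /\ g <= 2,
    foldl (@push R) X s1 p x /\ ends s2 p' y & ~ bad g (x + y)].
Proof.
elim: s X => [|a s IH] X /= /not_andP[] => [|//||].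
- move=> H; apply: contra_notP H => H g p p' x y ip ip' pp g2 hx hy.
  apply: contra_notP H => nb; exists [::], [::], g, p, p', x, y; split=> //.
- move=> H; apply: contra_notP H => H g p p' x y ip ip' pp g2 hx hy.
  apply: contra_notP H => nb; exists [::], (a :: s), g, p, p', x, y; split=> //.
- move=> /IH [s1 [s2 [g [p [p' [x [y [-> ? ? ? ?]]]]]]]].
  by exists (a :: s1), s2, g, p, p', x, y; split.
Qed.

(* A walk from [x] with one jump of size [h]: its positions are [x + P_k] before
   the jump and [x + P_k - h] after it. *)
Definition hybrid s zs x h := [/\ choice s zs, inW x, inW (x + sum zs - h) &
  forall k, inW (x + sum (take k zs)) \/ inW (x + sum (take k zs) - h)].

Lemma exists_hybrid (bad : R -> R -> Prop) s : all okstep s ->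
  ~ allbad bad (fun p x => x = p) s ->
  exists zs x h g, [/\ hybrid s zs x h, - g <= h, h <= g, g <= 2 &
    ~ bad g (x + (x + sum zs - h))].
Proof.
move=> hs /not_allbadP [s1 [s2 [g [p [p' [x [y [sE [ip ip'] [[n1 n2] g2] [hx hy] nb]]]]]]]].
move: hs; subst s; rewrite all_cat => /andP[hs1 hs2].
have [zs1 [c1 pE k1]] := reach_choice hs1 ip hx.
have [zs2 [c2 yE k2]] := ends_choice hs2 ip' hy.
have yE' : y = x + sum (zs1 ++ zs2) - (p - p').
  by rewrite sum_cat; arith.
exists (zs1 ++ zs2), x, (p - p'), g; split; bnd; last by rewrite -yE'.
split.
- exact: choice_cat.
- by have := k1 0%N; rewrite take0 sum_nil addr0.
- by rewrite -yE'; apply: ends_ranged hy.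
- move=> k; rewrite take_cat; case: ltnP => _; [left; exact: k1|right].
  rewrite sum_cat (_ : _ - _ = p' + sum (take (k - size zs1) zs2)) //; arith.
Qed.

(** With [y] the end of the walk and [p] a position, [2 P_k - P_m] is [2 p - (x + y + z)], minus [h]
    before the jump and plus [h] after it. The margin [g] absorbs [h]. *)
Lemma close_main s c zs x h g z : hybrid s zs x h -> - g <= h -> h <= g ->
  z = c.2 \/ z = - c.1 -> 9 + g <= x + (x + sum zs - h) + z ->
  x + (x + sum zs - h) + z <= 19 - g -> sol (rcons s c).
Proof.
move=> [cz [x0 x1] [y0 y1] hk] hg gh hz S1 S2.
exists (rcons zs z); first exact: choice_rcons.
move=> k; rewrite sum_rcons; have [hle|hlt] := leqP k (size zs).
  rewrite -cats1 takel_cat //.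
  by case: (hk k) => -[? ?]; arith.
by rewrite take_oversize ?size_rcons // sum_rcons; arith.
Qed.

(* The first step, taken down, is replaced by an up step from a start lower by
   its demand. *)
Lemma close_first a s c zs x h g : hybrid (a :: s) zs x h -> - g <= h -> h <= g ->
  0 <= c.1 -> 0 <= c.2 -> a.1 + a.2 <= 14 -> 0 <= a.1 -> 0 <= a.2 ->
  7 + g <= x -> 7 < a.2 ->
  9 + g <= x + (x + sum zs - h) - (a.1 + a.2) - c.1 ->
  x + (x + sum zs - h) - (a.1 + a.2) - c.1 <= 19 - g -> sol (rcons (a :: s) c).
Proof.
case: zs => [|z zs]; first by case.
move=> [/= [hz cz] [x0 x1] [y0 y1] hk] hg gh c1 c2 d14 a1 a2 xg a7 S1 S2.
(* A step up would end above 14, whether or not the jump is already made. *)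
have zE : z = - a.1.
  case: hz => // zE; have := hk 1%N; rewrite /= take0 sum_cons sum_nil zE => -[[? ?]|[? ?]]; arith.
rewrite sum_cons in S1 S2 y0 y1.
exists (a.2 :: rcons zs (- c.1)).
  by split; [left|apply: choice_rcons => //; right].
case=> [|k]; rewrite /= ?sum_nil !sum_cons sum_rcons; first by arith.
have [hle|hlt] := leqP k (size zs).
  rewrite -cats1 takel_cat //.
  have := hk k.+1; rewrite /= !sum_cons => -[[? ?]|[? ?]]; arith.
by rewrite take_oversize ?size_rcons // sum_rcons; arith.
Qed.

(* The last step, taken down, is replaced by an up step leaving the strip. *)
Lemma close_last s a c zs x h g : hybrid (rcons s a) zs x h -> - g <= h -> h <= g ->
  0 <= c.1 -> 0 <= c.2 -> 10 < a.1 + a.2 -> a.1 + a.2 <= 14 -> 0 <= a.1 -> 0 <= a.2 ->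
  x + sum zs - h + g <= 7 -> 7 < a.2 -> g <= 2 ->
  9 + g <= x + (x + sum zs - h) + (a.1 + a.2) + c.2 ->
  x + (x + sum zs - h) + (a.1 + a.2) + c.2 <= 19 - g -> sol (rcons (rcons s a) c).
Proof.
move=> [/choice_rconsP[zs' [z [zE cz hz]]] [x0 x1] [y0 y1] hk].
rewrite {}zE in y0 y1 hk *; rewrite sum_rcons in y0 y1 *.
move=> hg gh c1 c2 d10 d14 a1 a2 yg a7 g2 S1 S2.
have hk' k : (k <= size zs')%N -> inW (x + sum (take k zs')) \/ inW (x + sum (take k zs') - h).
  by move=> hl; have := hk k; rewrite -cats1 takel_cat.
(* A step up would have started below 0, whether or not the jump is already made. *)
have zE : z = - a.1.
  case: hz => // zE; have := hk' (size zs') (leqnn _); rewrite take_size => -[[? ?]|[? ?]]; arith.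
exists (rcons (rcons zs' a.2) c.2).
  by apply: choice_rcons; [apply: choice_rcons => //; left|left].
move=> k; rewrite !sum_rcons; have [hle|hlt] := leqP k (size zs').
  rewrite -cats1 takel_cat ?size_rcons ?(leq_trans hle) // -cats1 takel_cat //.
  by case: (hk' k hle) => -[? ?]; arith.
have [hle|hlt'] := leqP k (size zs').+1.
  rewrite -cats1 takel_cat ?size_rcons // take_oversize ?size_rcons // sum_rcons; arith.
by rewrite take_oversize ?size_rcons // !sum_rcons; arith.
Qed.

End Hybrid.
Arguments hybrid {R}.
Arguments reach {R}.

(** * Counting three good intervals *)

Section ThreeBands.
Variable R : realFieldType.
Implicit Types (t g : R).
Variables a1 b1 a2 b2 a3 b3 : R.

Definition outside g t :=
  [/\ t < a1 + g \/ b1 - g < t, t < a2 + g \/ b2 - g < t & t < a3 + g \/ b3 - g < t].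

(** A point outside an interval shrunk by [g] may still lie in the interval, but it is on a definite
    side of the midpoint when [g] is at most half the length. *)
Definition level t : R :=
  ((a1 + b1) / 2 < t)%R%:R + ((a2 + b2) / 2 < t)%R%:R + ((a3 + b3) / 2 < t)%R%:R.

(* The gaps between the good intervals [[a_i, b_i]] in [[0, 28]] have length at
   most [beta], the intervals length at least [G]. *)
Definition spaced (beta G : R) :=
  [/\ beta <= 6, beta + 4 <= G, 8 <= G, a1 <= beta & 28 - beta <= b3] /\
  [/\ b1 <= a2, a2 - b1 <= beta, b2 <= a3 & a3 - b2 <= beta] /\
  [/\ G <= b1 - a1, G <= b2 - a2, G <= b3 - a3, 18 <= b2 - a1 & 18 <= b3 - a2].

Lemma level_mono t t' : t <= t' -> level t <= level t'.
Proof.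
move=> tt; rewrite /level.
have H m : ((m < t)%R%:R : R) <= (m < t')%R%:R.
  by case: (ltP m t) => [mt|_]; [rewrite (lt_le_trans mt tt)|rewrite ler0n].
by rewrite !lerD.
Qed.

Lemma level_outside beta G g t : spaced beta G -> 0 <= g -> g <= 4 -> outside g t ->
  [\/ level t = 0 /\ t < a1 + g, level t = 1 /\ b1 - g < t < a2 + g,
      level t = 2 /\ b2 - g < t < a3 + g | level t = 3 /\ b3 - g < t].
Proof.
move=> [[h1 h2 h3 h4 h5] [[h6 h7 h8 h9] [h10 h11 h12 h13 h14]]] g0 g4 [z1 z2 z3].
rewrite /level; case: z1 => z1.
  apply: Or41; do 3! (case: ltP => ?; first by exfalso; arith).
  by rewrite /= !addr0.
case: z2 => z2.
  apply: Or42; case: ltP => ?; last by exfalso; arith.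
  do 2! (case: ltP => ?; first by exfalso; arith).
  by rewrite /= !addr0 z1 z2.
case: z3 => z3.
  apply: Or43; do 2! (case: ltP => ?; last by exfalso; arith).
  case: ltP => ?; first by exfalso; arith.
  by rewrite /= addr0 z2 z3; split=> //; ring.
apply: Or44; do 3! (case: ltP => ?; last by exfalso; arith).
by split=> //=; ring.
Qed.

(** Going up two levels means passing two intervals that span at least 18, which takes more than 14
    even with tolerances totalling 4. *)
Lemma level_jump beta G g g' t t' : spaced beta G -> 0 <= g -> 0 <= g' -> g + g' <= 4 ->
  outside g t -> outside g' t' -> t <= t' -> t' - t <= 14 ->
  (level t' = level t /\ (0 <= t -> t' <= 28 -> t' - t < beta + g + g')) \/
  (level t' = level t + 1 /\ G - g - g' < t' - t).
Proof.
move=> sp g0 g0' gg c c' tt tt14.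
have z := level_outside sp g0 ltac:(arith) c.
have z' := level_outside sp g0' ltac:(arith) c'.
case: sp => [[h1 h2 h3 h4 h5] [[h6 h7 h8 h9] [h10 h11 h12 h13 h14]]]; clear c c'.
case: z => [[-> z]|[-> /andP[z y]]|[-> /andP[z y]]|[-> z]];
  case: z' => [[-> z']|[-> /andP[z' y']]|[-> /andP[z' y']]|[-> z']];
  solve [by exfalso; arith | by left; split=> [//|? ?]; arith
        | by right; split; [ring|arith]].
Qed.

Lemma level_far beta G t t' : spaced beta G -> 0 <= t -> t' <= 28 -> 6 < t' - t ->
  outside 0 t -> outside 0 t' -> level t < level t'.
Proof.
move=> sp t0 t28 far c c'.
have z := level_outside sp (lexx _) ltac:(arith) c.
have z' := level_outside sp (lexx _) ltac:(arith) c'.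
case: sp => [[h1 h2 h3 h4 h5] [[h6 h7 h8 h9] [h10 h11 h12 h13 h14]]]; clear c c'.
by case: z => [[-> z]|[-> /andP[z y]]|[-> /andP[z y]]|[-> z]];
  case: z' => [[-> z']|[-> /andP[z' y']]|[-> /andP[z' y']]|[-> z']];
  arith.
Qed.

(* Going from [y] to [y'], the levels of [x + y] and [x' + y] jump alike: no jump
   moves less than [beta], a jump at least [G], up to tolerances. *)
Lemma level_four beta G x x' y y' g1 g2 g3 g4 : spaced beta G ->
  inW x -> inW x' -> inW y -> inW y' -> 0 <= g1 -> 0 <= g2 -> 0 <= g3 -> 0 <= g4 ->
  g1 + g2 + g3 + g4 <= 4 -> outside g1 (x + y) -> outside g2 (x' + y') ->
  outside g3 (x + y') -> outside g4 (x' + y) -> y <= y' ->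
  level (x + y) + level (x' + y') = level (x + y') + level (x' + y).
Proof.
move=> sp [x0 x1] [x0' x1'] [y0 y1] [y0' y1'] p1 p2 p3 p4 s4 c1 c2 c3 c4 yy.
have := level_jump sp p1 p3 ltac:(arith) c1 c3 ltac:(arith) ltac:(arith).
have := level_jump sp p4 p2 ltac:(arith) c4 c2 ltac:(arith) ltac:(arith).
case: sp => [[h1 h2 h3 h4 h5] _]; clear c1 c2 c3 c4.
move=> [[-> /(_ ltac:(arith) ltac:(arith)) q]|[-> q]];
  move=> [[-> /(_ ltac:(arith) ltac:(arith)) q']|[-> q']]; try ring; by exfalso; arith.
Qed.

Lemma level_near beta G t t' g g' : spaced beta G -> 0 <= g -> 0 <= g' -> g + g' <= 2 ->
  t <= t' -> t' - t <= 2 -> outside g t -> outside g' t' -> level t = level t'.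
Proof.
move=> sp g0 g0' gg tt tt2 c c'.
have := level_jump sp g0 g0' ltac:(arith) c c' tt ltac:(arith).
case: sp => [[h1 h2 h3 h4 h5] _] [[-> _]|[_ ?]] //; by exfalso; arith.
Qed.

Lemma spaced_bands beta G : spaced beta G -> bands level outside.
Proof.
move=> sp; split.
- exact: level_mono.
- move=> x x' y y' g1 g2 g3 g4 ix ix' iy iy' p1 p2 p3 p4 s4 c1 c2 c3 c4.
  have [yy|yy] := le_or_lt y y'.
    exact: (level_four sp ix ix' iy iy' p1 p2 p3 p4 s4).
  apply/esym; apply: (level_four sp ix ix' iy' iy p3 p4 p1 p2 _ c3 c4 c1 c2 (ltW yy)).
  by arith.
- move=> t t' g [n1 n2] g2 c c'; have [tt|tt] := le_or_lt t t'.
    by apply: (level_near sp _ _ _ tt _ c c'); arith.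
  by apply/esym; apply: (level_near sp _ _ _ (ltW tt) _ c' c); arith.
- by move=> t t'; apply: (level_far sp).
Qed.

End ThreeBands.

(** * Closing the walk with the demand kept aside *)

Section Cases.
Variable R : realFieldType.
Implicit Types (p x y z g h u v : R) (zs : seq R) (a b c : R * R) (s l : seq (R * R))
  (bs : seq ((R * R) * (R * R))).

Lemma min_cases (t t' : R) :
  [/\ Num.min t t' <= t, Num.min t t' <= t' & Num.min t t' = t \/ Num.min t t' = t'].
Proof.
have [h|h] := le_or_lt t t'.
  by rewrite (min_idPl h); split=> //; left.
by rewrite (min_idPr (ltW h)); split; [exact: ltW| |right].
Qed.

Lemma max_cases (t t' : R) :
  [/\ t <= Num.max t t', t' <= Num.max t t' & Num.max t t' = t \/ Num.max t t' = t'].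
Proof.
have [h|h] := le_or_lt t t'.
  by rewrite (max_idPr h); split=> //; right.
by rewrite (max_idPl (ltW h)); split; [|exact: ltW|left].
Qed.

Lemma not_outside (a1 b1 a2 b2 a3 b3 g t : R) : ~ outside a1 b1 a2 b2 a3 b3 g t ->
  [\/ a1 + g <= t <= b1 - g, a2 + g <= t <= b2 - g | a3 + g <= t <= b3 - g].
Proof.
move=> H.
have cut (a b : R) : a + g <= t <= b - g \/ (t < a + g \/ b - g < t).
  have [h1|h1] := le_or_lt (a + g) t; last by right; left.
  have [h2|h2] := le_or_lt t (b - g); last by right; right.
  by left; rewrite h1.
case: (cut a1 b1) => [|h1]; first by move=> ?; apply: Or31.
case: (cut a2 b2) => [|h2]; first by move=> ?; apply: Or32.
case: (cut a3 b3) => [|h3]; first by move=> ?; apply: Or33.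
by case: H; split.
Qed.

(** The closing values accept [x + y] in [[9 - c.2, 19 - c.2]] and [[9 + c.1, 19 + c.1]]. These meet
    since [c.1 + c.2 <= 10], and their union has length at least 14 since [4 <= c.1 + c.2], so one
    start suits every end. *)
Lemma close_mid s c : all okstep s -> okstep c -> 4 <= c.1 + c.2 -> c.1 + c.2 <= 10 ->
  sol (rcons s c).
Proof.
move=> hs /and3P[c1 c2 c3] d4 d10.
pose x := Num.max 0 (9 - c.2).
have [x0 x1 x2] : [/\ 0 <= x, 9 - c.2 <= x & x <= 5 + c.1].
  by rewrite /x; split; rewrite ?le_max ?lexx ?orbT // ge_max; apply/andP; split; arith.
have x3 : x <= 14 by rewrite /x ge_max; apply/andP; split; arith.
have ix : inW x by split.
have [y hy] := ends_total hs ix; have [y0 y1] := ends_ranged hs ix hy.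
have [zs [cz yE hk]] := ends_choice hs ix hy.
have hyb : hybrid s zs x 0.
  by split=> //; [rewrite -yE subr0; split|left; exact: hk].
have [h|h] := le_or_lt (x + y) (19 - c.2).
  by apply: (close_main (g := 0) (z := c.2) hyb); rewrite ?subr0 -?yE; (try by left); arith.
by apply: (close_main (g := 0) (z := - c.1) hyb); rewrite ?subr0 -?yE; (try by right); arith.
Qed.

Definition flat bs : seq (R * R) := foldr (fun ab s => ab.1 :: ab.2 :: s) [::] bs.
Definition alternating bs := all (fun ab => small ab.1 && big ab.2) bs.

Lemma stepsE bs e : steps bs e = rcons (flat bs) e.
Proof. by elim: bs => //= ab bs ->. Qed.

Lemma flat_cat bs bs' : flat (bs ++ bs') = flat bs ++ flat bs'.
Proof. by elim: bs => //= ab bs ->. Qed.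

Definition swap2 (ab : (R * R) * (R * R)) := (swap ab.1, swap ab.2).

Lemma flat_swap bs : flat (map swap2 bs) = map swap (flat bs).
Proof. by elim: bs => //= ab bs ->. Qed.

Lemma okstep_swap a : okstep (swap a) = okstep a.
Proof. by rewrite /okstep /= addrC andbCA. Qed.

Lemma small_swap a : small (swap a) = small a.
Proof. by rewrite /small okstep_swap /= addrC. Qed.

Lemma big_swap a : big (swap a) = big a.
Proof. by rewrite /big okstep_swap /= addrC. Qed.

Lemma alternating_swap bs : alternating (map swap2 bs) = alternating bs.
Proof. by rewrite /alternating all_map; apply: eq_all => ab /=; rewrite small_swap big_swap. Qed.

Lemma small0 : small (0 : R, 0 : R).
Proof. by apply/andP; split; [apply/and3P; split|]; rewrite /= ?addr0. Qed.

(** The gap between the two closing intervals is at most 4, and parts above 3 leave less than 6 of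
    [[0, 28]] uncovered at either side. *)
Lemma close_rich bs e c : alternating bs -> small e -> big c -> 3 < c.1 -> 3 < c.2 ->
  sol (rcons (steps bs e) c).
Proof.
move=> hbs se /andP[/and3P[_ _ c14] c10] c1 c2.
(* The first interval is a dummy: [x + y] cannot reach it. *)
have hb : bands (level (- 7 - c.2) (3 - c.2) (9 - c.2) (19 - c.2) (9 + c.1) (19 + c.1))
    (outside (- 7 - c.2) (3 - c.2) (9 - c.2) (19 - c.2) (9 + c.1) (19 + c.1)).
  by apply: (@spaced_bands R _ _ _ _ _ _ 6 10); split; [|split]; split; arith.
have [zs [x [h [g [hyb hg gh g2 /not_outside S]]]]] :=
  exists_hybrid (steps_ok hbs se) (not_allbad hb hbs se).
case: (hyb) => _ [x0 x1] [y0 y1] _.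
case: S => /andP[S1 S2].
- by exfalso; arith.
- by apply: (close_main (z := c.2) hyb hg gh); (try by left); arith.
- by apply: (close_main (z := - c.1) hyb hg gh); (try by right); arith.
Qed.

(** The zero demands pad a sequence with big ends to the shape of [steps]. *)
Lemma hybrid_strip s zs x h : hybrid ((0, 0) :: rcons s (0, 0)) zs x h ->
  exists zs', hybrid s zs' x h /\ sum zs' = sum zs.
Proof.
case: zs => [|z zs1]; first by case.
move=> [/= [hz /choice_rconsP[zs [w [-> cz hw]]]] ix iy hk].
have z0 : z = 0 by case: hz => -> //=; rewrite oppr0.
have w0 : w = 0 by case: hw => -> //=; rewrite oppr0.
have sE : sum (z :: rcons zs w) = sum zs by rewrite sum_cons sum_rcons z0 w0 add0r addr0.
exists zs; rewrite sE; split=> //; split=> //; first by rewrite -sE.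
move=> k; rewrite -(take_minn_size k zs); have := hk (minn k (size zs)).+1.
by rewrite /= -cats1 takel_cat ?geq_minr // sum_cons z0 add0r.
Qed.

(* Besides closing with either part of [c], one may reverse the first or the
   last step, which is a step down when [x] is large, resp. [y] small. *)
Lemma close_typed bs s aF sF aL sL c : alternating bs -> small c ->
  (0, 0) :: rcons s (0, 0) = steps bs (0, 0) ->
  s = aF :: sF -> s = rcons sL aL -> big aF -> big aL -> aF.1 <= 3 -> aL.1 <= 3 ->
  sol (rcons s c).
Proof.
move=> hbs /andP[/and3P[c1 c2 _] c4] sE sF' sL' /andP[/and3P[f1 f2 f14] f10].
move=> /andP[/and3P[l1 l2 l14] l10] f3 l3.
(* The bounds 7 and 21 force an end at most [7 - g] in the first interval and a start at least
   [7 + g] in the third, so that the step to be reversed is a step down. *)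
pose b1 := Num.min 7 (19 - aL.1 - aL.2 - c.2).
pose a3 := Num.max 21 (9 + aF.1 + aF.2 + c.1).
have [b17 b1L b1c] : [/\ b1 <= 7, b1 <= 19 - aL.1 - aL.2 - c.2 &
    b1 = 7 \/ b1 = 19 - aL.1 - aL.2 - c.2].
  exact: min_cases.
have [a321 a3F a3c] : [/\ 21 <= a3, 9 + aF.1 + aF.2 + c.1 <= a3 &
    a3 = 21 \/ a3 = 9 + aF.1 + aF.2 + c.1].
  exact: max_cases.
have hb : bands (level (9 - aL.1 - aL.2 - c.2) b1 (9 - c.2) (19 + c.1) a3
     (19 + aF.1 + aF.2 + c.1))
   (outside (9 - aL.1 - aL.2 - c.2) b1 (9 - c.2) (19 + c.1) a3
     (19 + aF.1 + aF.2 + c.1)).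
  by apply: (@spaced_bands R _ _ _ _ _ _ 4 8); split; [|split]; split; arith.
have [zs' [x [h [g [hyb' hg gh g2 /not_outside S]]]]] :=
  exists_hybrid (steps_ok hbs small0) (not_allbad hb hbs small0).
move: hyb'; rewrite -sE => /hybrid_strip [zs [hyb zsE]]; rewrite -zsE in S.
case: (hyb) => _ [x0 x1] [y0 y1] _; clear b1c a3c.
case: S => /andP[S1 S2].
- by rewrite sL' in hyb *; apply: (close_last hyb hg gh) => //; clear sF' sL' sE; arith.
- clear sF' sL' sE.
  have [hh|hh] := le_or_lt (x + (x + sum zs - h)) (19 - c.2 - g).
    by apply: (close_main (z := c.2) hyb hg gh); (try by left); arith.
  by apply: (close_main (z := - c.1) hyb hg gh); (try by right); arith.
- by rewrite sF' in hyb *; apply: (close_first hyb hg gh) => //; clear sF' sL' sE; arith.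
Qed.

End Cases.
Arguments flat {R}.
Arguments alternating {R}.
Arguments swap2 {R}.

(** * Reduction of arbitrary sequences to alternating ones *)

Section Combine.
Variable R : realFieldType.
Implicit Types (zs : seq R) (a b c : R * R) (s l : seq (R * R))
  (bs : seq ((R * R) * (R * R))).

Lemma swapK : involutive (swap : R * R -> R * R).
Proof. by case. Qed.

Lemma map_swapK l : map swap (map swap l) = l.
Proof. by rewrite -map_comp map_id_in // => a _; rewrite /= swapK. Qed.

Lemma sol_swapE l : sol l -> sol (map swap l).
Proof. by move=> h; apply: sol_swap; rewrite map_swapK. Qed.

Lemma sol_rots' l l' : sol (l ++ l') -> sol (l' ++ map swap l).
Proof.
move=> h; apply: sol_rots; rewrite -map_cat; exact: sol_swapE.
Qed.

Definition nonzero a := a != (0, 0).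

Lemma sol_filter l : sol (filter nonzero l) <-> sol l.
Proof.
have cons0 a s : a = (0, 0) -> sol (a :: s) <-> sol s.
  move=> ->; split=> [/(@sol_rots' [:: _])|h].
    by rewrite /= cats1 => /sol_drop0.
  apply: sol_rot; case: h => zs cz h; exists (rcons zs 0).
    by apply: choice_rcons => //; left.
  by move=> k; rewrite sum_rcons addr0; have := h k;
    have [hk|hk] := leqP k (size zs); rewrite -?cats1;
    [rewrite takel_cat|rewrite !take_oversize ?size_cat ?addn1 //; [rewrite cats1 sum_rcons addr0|exact: ltnW]].
(* The suffix [s'] makes room for rotating a kept head to the end. *)
suff H s s' : sol (filter nonzero s ++ s') <-> sol (s ++ s') by have := H l [::]; rewrite !cats0.
elim: s s' => [|a s IH] s' //=; rewrite /nonzero; case: eqP => [a0|_] /=.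
  by rewrite IH; split => /cons0; apply.
split=> /(@sol_rots' [:: _]) h; apply: (@sol_rots _ [:: _]); move: h.
  by rewrite /= -!catA => /IH.
by rewrite /= -!catA => /IH.
Qed.

(** A zero demand counts as small and is inserted before every big demand that no small one
    precedes. *)
Lemma alternate l : all (fun a => small a || big a) l ->
  sorted (fun a b => big a || big b) l -> (forall a s, l = rcons s a -> big a) ->
  exists2 bs, alternating bs & filter nonzero (flat bs) = filter nonzero l.
Proof.
have [m] := ubnP (size l); elim: m l => // m IH [|a l] //= lm; first by exists [::].
move=> /andP[+ hl] hp hlast.
have [ba _|nba /=] := boolP (big a).
  have [|bs hbs bsE] := IH l lm hl (path_sorted hp).
    by move=> a' s' lE; apply: (hlast a' (a :: s')); rewrite lE.
  exists (((0, 0), a) :: bs); first by rewrite /= small0 ba.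
  by rewrite /= {1}/nonzero eqxx /= bsE.
rewrite orbF => sa; case: l lm hl hp hlast => [|b l] /= lm; first by move=> _ _ /(_ a [::] erefl); rewrite (negbTE nba).
move=> /andP[_ hl] /andP[+ hp] hlast; rewrite (negbTE nba) /= => bb.
have [|bs hbs bsE] := IH l (ltnW lm) hl (path_sorted hp).
  by move=> a' s' lE; apply: (hlast a' (a :: b :: s')); rewrite lE.
by exists ((a, b) :: bs); rewrite /= ?sa ?bb // bsE.
Qed.

Definition down b := b.1 <= 3.

(** Rotated to the end, the first small demand becomes the closing one, and the rest begins and ends
    with big demands of one type, as [close_typed] wants; if they are not [down], all parts are
    exchanged first. *)
Lemma sol_same ab bs : alternating (ab :: bs) ->
  all (fun ab => (ab.2.1 <= 3) || (ab.2.2 <= 3)) (ab :: bs) ->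
  down ab.2 = down (last ab bs).2 -> sol (flat (ab :: bs)).
Proof.
case: ab => a b hbs typ hd.
have bigL : big (last (a, b) bs).2.
  by have /allP/(_ _ (mem_last _ _)) := hbs => /andP[].
have typL : ((last (a, b) bs).2.1 <= 3) || ((last (a, b) bs).2.2 <= 3).
  by have /allP/(_ _ (mem_last _ _)) := typ.
have [sL sLE] : exists sL, b :: flat bs = rcons sL (last (a, b) bs).2.
  elim/last_ind: bs {hbs typ hd bigL typL} => [|bs [a' b'] _]; first by exists [::].
  exists (b :: rcons (flat bs) a').
  by rewrite last_rcons -cats1 flat_cat /= -cat_rcons cats1.
move: hbs => /= /andP[/andP[/= sa sb] hbs].
have alt0 b0 bs0 : big b0 -> alternating bs0 -> alternating (((0, 0), b0) :: bs0).
  by move=> h1 h2; rewrite /= small0 h1.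
apply: (@sol_rot _ a (b :: flat bs)).
have [db|] := boolP (down b).
  apply: (@close_typed _ _ _ b (flat bs) _ sL _ (alt0 _ _ sb hbs)) => //.
  - by rewrite small_swap.
  - by rewrite stepsE.
  - exact: sLE.
  - exact: bigL.
  - by rewrite -[_ <= 3]/(down (last (a, b) bs).2) -hd.
move=> ndb; have ub : b.2 <= 3.
  by have /andP[/orP[|//]] := typ; rewrite -[_ <= 3]/(down b) (negbTE ndb).
have uL : (last (a, b) bs).2.2 <= 3.
  by move: typL; rewrite -[(last (a, b) bs).2.1 <= 3]/(down (last (a, b) bs).2) -hd (negbTE ndb).
apply: sol_swap; rewrite map_rcons.
apply: (@close_typed _ (((0, 0), swap b) :: map swap2 bs) _ (swap b) (map swap (flat bs)) (swap (last (a, b) bs).2) (map swap sL)) => //.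
- by apply: alt0; [rewrite big_swap|rewrite -/(alternating _) alternating_swap].
- by rewrite stepsE /= flat_swap.
- by rewrite sLE map_rcons.
- by rewrite big_swap.
- by rewrite big_swap.
Qed.

(** A big demand with both parts above 3 is rotated to the end and closes the walk. Otherwise every
    big demand has exactly one part at most 3, and [swap] flips its type. *)
Lemma sol_flat bs : bs != [::] -> alternating bs -> sol (flat bs).
Proof.
move=> bs0 hbs.
have rot bs1 bs2 : sol (flat (bs2 ++ map swap2 bs1)) -> sol (flat (bs1 ++ bs2)).
  by rewrite !flat_cat flat_swap; apply: sol_rots.
have [/hasP[[a b] hin /= /andP[b1 b2]]|] :=
    boolP (has (fun ab => (3 < ab.2.1) && (3 < ab.2.2)) bs).
  have [bs1 [bs2 bsE]] : exists bs1 bs2, bs = bs1 ++ (a, b) :: bs2.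
    by case/splitPr: hin => bs1 bs2; exists bs1, bs2.
  rewrite bsE in hbs *.
  have /and3P[h1 /andP[/= sa sb] h2] : [&& alternating bs1, small a && big b & alternating bs2].
    by move: hbs; rewrite /alternating all_cat /=.
  have -> : flat (bs1 ++ (a, b) :: bs2) = (flat bs1 ++ [:: a; b]) ++ flat bs2.
    by rewrite flat_cat /= -catA.
  apply: sol_rots; rewrite map_cat -flat_swap catA -flat_cat /= -cat_rcons cats1 -stepsE.
  apply: close_rich; rewrite ?small_swap ?big_swap //.
  by rewrite /alternating all_cat -!/(alternating _) h2 alternating_swap.
rewrite -all_predC => /allP typ'.
have typ : all (fun ab => (ab.2.1 <= 3) || (ab.2.2 <= 3)) bs.
  by apply/allP => ab /typ' /=; rewrite negb_and -!leNgt.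
case: bs bs0 hbs {typ'} typ => // ab bs _ hbs typ.
have [dd|] := eqVneq (down ab.2) (down (last ab bs).2); first exact: sol_same.
(* If the first and last types differ, so do two neighbouring ones. Cutting the cyclic sequence
   there swaps one of the two, and the new ends agree. *)
have H : down ab.2 != down (last ab bs).2 ->
    exists bs1 ab1 ab2 bs2, ab :: bs = rcons bs1 ab1 ++ ab2 :: bs2 /\
      down ab1.2 != down ab2.2.
  elim: bs ab {hbs typ rot} => [|ab' bs IH] ab /=; first by rewrite eqxx.
  have [-> /IH [bs1 [ab1 [ab2 [bs2 [-> h]]]]]|dd _] := eqVneq (down ab.2) (down ab'.2).
    by exists (ab :: bs1), ab1, ab2, bs2.
  by exists [::], ab, ab', bs.
move=> /H [bs1 [ab1 [ab2 [bs2 [bsE dd]]]]]; rewrite bsE in hbs typ *.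
apply: rot; rewrite cat_cons; apply: sol_same.
- rewrite -cat_cons /alternating all_cat -!/(alternating _) alternating_swap.
  by move: hbs; rewrite /alternating all_cat -!/(alternating _) => /andP[-> ->].
- move: typ; rewrite -cat_cons !all_cat all_map => /andP[h1 ->] /=.
  by rewrite -(eq_all (a1 := fun ab => (ab.2.1 <= 3) || (ab.2.2 <= 3))) // => ab0; rewrite /= orbC.
- rewrite map_rcons last_cat last_rcons /=.
  have b1 : big ab1.2.
    by move: hbs; rewrite /alternating all_cat all_rcons => /andP[/andP[/andP[]]].
  have t1 : (ab1.2.1 <= 3) || (ab1.2.2 <= 3).
    by move: typ; rewrite all_cat all_rcons => /andP[/andP[]].
  have -> : down (swap ab1.2) = ~~ down ab1.2.
    move: b1 t1 => /andP[_ b10]; rewrite /down /=.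
    case: (leP ab1.2.1 3) => h1; case: (leP ab1.2.2 3) => h2 //= _.
    by exfalso; clear bsE; arith.
  by move: dd; case: (down ab1.2); case: (down ab2.2).
Qed.

Lemma unsortedP (T : Type) (e : rel T) (t : seq T) : ~~ sorted e t ->
  exists t1 x y t2, t = t1 ++ x :: y :: t2 /\ ~~ e x y.
Proof.
elim: t => // x [|y t] IH //= /nandP[h|h]; first by exists [::], x, y, t.
by have [t1 [x' [y' [t2 [-> ?]]]]] := IH h; exists (x :: t1), x', y', t2.
Qed.

Lemma all_okstep_swap l : all okstep (map swap l) = all okstep l.
Proof. by rewrite all_map; apply: eq_all => a; exact: okstep_swap. Qed.

(** Induction on the length: two adjacent small demands are merged. A demand in [[4, 10]] closes
    directly, and without either the sequence alternates up to zero demands. *)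
Theorem sol_all l : all okstep l -> sol l.
Proof.
have [m] := ubnP (size l); elim: m l => // m IH l lm hl.
have [/hasP[c cl /andP[c4 c10]]|mid] :=
    boolP (has (fun c => (4 <= c.1 + c.2) && (c.1 + c.2 <= 10)) l).
  have [s1 [s2 lE]] : exists s1 s2, l = s1 ++ c :: s2.
    by case/splitPr: cl => s1 s2; exists s1, s2.
  move: hl; rewrite lE all_cat /= => /and3P[h1 oc h2].
  rewrite -cat_rcons; apply: sol_rots; rewrite map_rcons -rcons_cat.
  apply: close_mid; rewrite ?okstep_swap //= 1?addrC //.
  by rewrite all_cat h2 all_okstep_swap.
have sb : all (fun a => small a || big a) l.
  apply/allP => a al; have oa := allP hl _ al.
  have := hasPn mid _ al; rewrite negb_and -!ltNge /small /big oa /=.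
  by case/orP => ->; rewrite ?orbT.
have merge s1 a b s2 : all okstep (s1 ++ a :: b :: s2) -> (size (s1 ++ a :: b :: s2) <= m)%N ->
    small a -> small b -> sol (s1 ++ a :: b :: s2).
  rewrite all_cat /= size_cat /= => /and4P[h1 oa ob h2] sz sa sb'.
  apply: sol_rots => /=.
  case/andP: sa => /and3P[a1 a2 _] a4; case/andP: sb' => /and3P[b1 b2 _] b4.
  apply: sol_merge => //; apply: IH.
    by rewrite /= size_cat size_map; move: sz; rewrite !addnS addnC.
  rewrite /= all_cat h2 all_okstep_swap h1 !andbT.
  by apply/and3P; split => /=; arith.
case/lastP: l => [|l b] in lm hl sb {mid} *; first by exists [::] => // k; rewrite /= sum_nil; lra.
have big0 a : big a -> nonzero a.
  by move=> /andP[_]; apply: contraL => /eqP -> /=; rewrite addr0 -leNgt.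
have main l' : all okstep l' -> all (fun a => small a || big a) l' -> (size l' <= m)%N ->
    (exists2 a, exists s, l' = rcons s a & big a) -> sol l'.
  move=> hl' sb' lm' [a [s lE] ba].
  have [hp|/unsortedP [s1 [a1 [a2 [s2 [lE' /norP[n1 n2]]]]]]] :=
      boolP (sorted (fun a b => big a || big b) l'); last first.
    rewrite lE' in hl' lm' sb' *; apply: merge => //.
      by move: sb'; rewrite all_cat /= (negbTE n1) orbF => /and3P[].
    by move: sb'; rewrite all_cat /= (negbTE n2) orbF => /and4P[].
  have [|bs hbs bsE] := alternate sb' hp.
    by move=> a' s'; rewrite lE => /rcons_inj[_ <-].
  apply/sol_filter; rewrite -bsE; apply/sol_filter; apply: sol_flat => //.
  by apply/eqP => bs0; move: bsE; rewrite bs0 lE filter_rcons big0 // => /(congr1 size); rewrite size_rcons.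
have [bb|nb] := boolP (big b); first by apply: main => //; exists b => //; exists l.
have sb' : small b by move: sb; rewrite all_rcons (negbTE nb) orbF => /andP[].
case/lastP: l => [|l a] in lm hl sb *.
  case/andP: sb' => /and3P[b1 b2 b14] _.
  exists [:: b.2]; first by split=> //; left.
  by case=> [|[|k]] /=; rewrite !sum_cons ?sum_nil; clear IH main merge; apply/andP; split; lra.
have [ba|na] := boolP (big a); last first.
  have lE : rcons (rcons l a) b = l ++ [:: a; b] by rewrite -!cats1 -catA.
  rewrite lE; apply: merge; rewrite -?lE //.
  by move: sb; rewrite !all_rcons (negbTE na) orbF => /and3P[].
(* A small last demand is rotated to the front, so that the sequence ends with a big one. *)
rewrite -(swapK b) -cats1; apply: (@sol_rots' [:: swap b]).
rewrite /=; apply: main.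
- by move: hl; rewrite all_rcons /= okstep_swap.
- by move: sb; rewrite all_rcons /= small_swap big_swap.
- by move: lm; rewrite size_rcons.
- by exists a => //; exists (swap b :: l); rewrite rcons_cons.
Qed.

End Combine.

(** * Rounding the split demands of a ring *)

Section Rounding.
Variable R : realFieldType.

Lemma sol_scaled (D : R) (l : seq (R * R)) : 0 <= D ->
  (forall a, a \in l -> [/\ 0 <= a.1, 0 <= a.2 & a.1 + a.2 <= D]) ->
  exists2 zs, choice l zs &
    forall k, `|2 * sum (take k zs) - sum zs| <= 19 / 14 * D.
Proof.
move=> D0 hl; have [D00|Dn] := eqVneq D 0.
  exists (nseq (size l) 0).
    elim: l hl => //= a l IH hl; split; last first.
      by apply: IH => b bl; apply: hl; rewrite inE bl orbT.
    have [a1 a2 a3] := hl a (mem_head _ _).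
    by left; rewrite D00 in a3; apply/eqP; rewrite eq_le; lra.
  have s0 m : sum (nseq m 0) = 0 :> R by elim: m => [|m IH]; rewrite /= ?sum_nil ?sum_cons ?IH ?addr0.
  move=> k; have -> : take k (nseq (size l) 0) = nseq (minn k (size l)) 0 :> seq R.
    by rewrite -take_minn_size size_nseq take_nseq ?geq_minr.
  by rewrite !s0 D00 !mulr0 subr0 normr0.
have Dp : 0 < D by rewrite lt_def Dn.
have [r rp rD] : exists2 r : R, 0 < r & r * D = 14.
  by exists (14 / D); rewrite ?divr_gt0 ?divfK.
have [|zs cz hz] := @sol_all R (map (fun a => (r * a.1, r * a.2)) l).
  apply/allP => _ /mapP[a /hl [a1 a2 a3] ->]; rewrite /okstep /=.
  by apply/and3P; split; rewrite /= ?mulr_ge0 ?(ltW rp) // -mulrDr -rD ler_pM2l.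
exists (map (fun z => z / r) zs).
  elim: l zs cz {hl hz} => [|a l IH] [|z zs] //= [hz /IH]; split=> //.
  by case: hz => -> /=; [left|right]; rewrite -?mulrN mulrC mulKf // gt_eqF.
have sM t : sum (map (fun z => z / r) t) = sum t / r.
  by elim: t => [|z t IH]; rewrite /= ?sum_nil ?mul0r // !sum_cons IH mulrDl.
move=> k; rewrite -map_take !sM mulrA -mulrBl normrM.
rewrite [`|r^-1|]gtr0_norm ?invr_gt0 // ler_pdivrMr //.
have -> : 19 / 14 * D * r = 19 by rewrite -mulrA [D * r]mulrC rD divfK ?pnatr_eq0.
by rewrite ler_norml hz.
Qed.

(** The hypothesis says that [b] holds exactly on an initial segment of [l]; [k] is its length. *)
Lemma prefix_sum (T : eqType) (l : seq T) (b : pred T) (z : T -> R) :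
  pairwise (fun p q => b q ==> b p) l -> exists k,
  \sum_(p <- l) (if b p then z p else - z p) =
    2 * sum (take k (map z l)) - sum (map z l).
Proof.
elim: l => [|p l IH] /=; first by exists 0%N; rewrite big_nil sum_nil mulr0 subr0.
move=> /andP[hp /IH [k kE]]; rewrite big_cons; have [bp|nb] := boolP (b p).
  by exists k.+1; rewrite /= !sum_cons kE; ring.
exists 0%N; rewrite take0 sum_nil mulr0 sub0r sum_cons opprD; congr (_ + _).
elim: l hp {IH kE} => [|q l IH] /=; first by rewrite big_nil sum_nil oppr0.
move=> /andP[/implyP hq /IH]; rewrite big_cons sum_cons opprD => ->.
by case: ifP => // /hq; rewrite (negbTE nb).
Qed.

Variable n : nat.
Implicit Types (p q : 'I_n * 'I_n) (e : 'I_n).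

Definition on_cw p e := (p.1 <= e < p.2)%N.
Definition pair_load (d f : 'I_n * 'I_n -> R) e :=
  \sum_(p : 'I_n * 'I_n | (p.1 < p.2)%N) if on_cw p e then f p else d p - f p.
Definition crosses p q := (p.1 < q.1 < p.2)%N && (p.2 < q.2)%N.
Definition split_pairs (d f : 'I_n * 'I_n -> R) :=
  [set p : 'I_n * 'I_n | (p.1 < p.2)%N && (0 < f p < d p)].
Definition sign (b : bool) : R := if b then 1 else -1.

Lemma pair_loadB d f g e : pair_load d g e - pair_load d f e =
  \sum_(p : 'I_n * 'I_n | (p.1 < p.2)%N) sign (on_cw p e) * (g p - f p).
Proof.
rewrite /pair_load -sumrB; apply: eq_bigr => p _.
by case: on_cw; rewrite /sign; ring.
Qed.

(* Directions in which flow can be moved without increasing any load. *)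
Lemma noncrossing_signs p q : (p.1 < p.2)%N -> (q.1 < q.2)%N ->
  ~~ crosses p q -> ~~ crosses q p -> exists b c, forall e,
  sign b * sign (on_cw p e) + sign c * sign (on_cw q e) <= 0 :> R.
Proof.
case: p q => [i j] [k l]; rewrite /crosses /on_cw /= => ij kl n1 n2.
(* Disjoint clockwise paths both gain flow; if one contains the other, the inner one gains and the
   outer one loses. *)
have [h1|h1] := boolP ((j <= k)%N || (l <= i)%N).
  exists true, true => e; rewrite /sign.
  by case: ifP => he; case: ifP => hf; try lra; exfalso; lia.
have [h2|h2] := boolP ((i <= k)%N && (l <= j)%N).
  exists false, true => e; rewrite /sign.
  by case: ifP => he; case: ifP => hf; try lra; exfalso; lia.
exists true, false => e; rewrite /sign.
by case: ifP => he; case: ifP => hf; try lra; exfalso; lia.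
Qed.

(** Induction on the number of split demands: moving as much flow as possible along a noncrossing
    pair unsplits one of the two. *)
Lemma uncross (d f : 'I_n * 'I_n -> R) : (forall p, (p.1 < p.2)%N -> 0 <= f p <= d p) -> exists g,
  [/\ forall p, (p.1 < p.2)%N -> 0 <= g p <= d p,
      forall e, pair_load d g e <= pair_load d f e &
      {in split_pairs d g &, forall p q, p != q -> crosses p q || crosses q p}].
Proof.
have [m] := ubnP #|split_pairs d f|; elim: m f => // m IH f fm hf.
have [hx|] := boolP [forall p in split_pairs d f, forall q in split_pairs d f,
    (p != q) ==> (crosses p q || crosses q p)].
  exists f; split=> // p q hp hq pq.
  by have /forall_inP/(_ p hp)/forall_inP/(_ q hq)/implyP/(_ pq) := hx.
rewrite negb_forall_in => /exists_inP[p hp]; rewrite negb_forall_in => /exists_inP[q hq].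
rewrite negb_imply negb_or => /and3P[pq n1 n2].
have := hp; rewrite inE => /and3P[pl p0 pd]; have := hq; rewrite inE => /and3P[ql q0 qd].
have [b [c hs]] := noncrossing_signs pl ql n1 n2.
pose room b0 p0 : R := if b0 then d p0 - f p0 else f p0.
pose eps := Num.min (room b p) (room c q).
have rp : 0 < room b p by rewrite /room; case: (b); lra.
have rq : 0 < room c q by rewrite /room; case: (c); lra.
have e0 : 0 < eps by rewrite /eps lt_min rp.
have [ep eq_ ec] : [/\ eps <= room b p, eps <= room c q & eps = room b p \/ eps = room c q].
  by rewrite /eps; case: (leP (room b p)) => [h|/ltW h]; split=> //; [left|right].
pose f' x := f x + (if x == p then sign b * eps else 0) + (if x == q then sign c * eps else 0).
have f'p : f' p = f p + sign b * eps by rewrite /f' eqxx (negbTE pq) addr0.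
have f'q : f' q = f q + sign c * eps by rewrite /f' eqxx eq_sym (negbTE pq) addr0.
have f'x x : x != p -> x != q -> f' x = f x.
  by rewrite /f' => /negbTE -> /negbTE ->; rewrite !addr0.
have hf' (x : 'I_n * 'I_n) : (x.1 < x.2)%N -> 0 <= f' x <= d x.
  move=> xl; have [->|xp] := eqVneq x p.
    by rewrite f'p /sign; move: ep; rewrite /room; case: (b) => ?; apply/andP; split; lra.
  have [->|xq] := eqVneq x q; last by rewrite f'x // hf.
  by rewrite f'q /sign; move: eq_; rewrite /room; case: (c) => ?; apply/andP; split; lra.
have sub : split_pairs d f' \proper split_pairs d f.
  apply/properP; split.
    apply/subsetP => x; have [->//|xp] := eqVneq x p; have [->//|xq] := eqVneq x q.
    by rewrite !inE f'x.
  case: ec => ec; [exists p => //|exists q => //]; rewrite inE ?pl ?ql /= negb_and -!leNgt.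
    by rewrite f'p ec /room /sign; case: (b); apply/orP; [right|left]; lra.
  by rewrite f'q ec /room /sign; case: (c); apply/orP; [right|left]; lra.
have [|g [g1 g2 g3]] := IH f' _ hf'.
  by apply: leq_trans (proper_card sub) _; rewrite -ltnS.
exists g; split=> // e; apply: le_trans (g2 e) _.
rewrite -subr_le0 pair_loadB.
have -> : \sum_(x : 'I_n * 'I_n | (x.1 < x.2)%N) sign (on_cw x e) * (f' x - f x) =
   eps * (sign b * sign (on_cw p e) + sign c * sign (on_cw q e)).
  rewrite (bigD1 p) //= (bigD1 q) /=; last by rewrite ql eq_sym.
  rewrite big1 ?addr0; first by rewrite f'p f'q; ring.
  by move=> x /andP[/andP[_ xp] xq]; rewrite f'x // subrr mulr0.
by rewrite pmulr_rle0.
Qed.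

Lemma crossing_rounding (d f : 'I_n * 'I_n -> R) (D : R) : 0 <= D ->
  (forall p, (p.1 < p.2)%N -> 0 <= f p <= d p /\ d p <= D) ->
  {in split_pairs d f &, forall p q, p != q -> crosses p q || crosses q p} ->
  exists g, (forall p, (p.1 < p.2)%N -> g p = 0 \/ g p = d p) /\
    forall e, pair_load d g e - pair_load d f e <= 19 / 14 * D.
Proof.
move=> D0 hf hx.
pose le1 p q := (p.1 <= q.1)%N.
pose l := sort le1 (enum (split_pairs d f)).
have lu : uniq l by rewrite sort_uniq enum_uniq.
have lin p : (p \in l) = (p \in split_pairs d f) by rewrite mem_sort mem_enum.
have lx : pairwise crosses l.
  have : pairwise le1 l.
    rewrite -sorted_pairwise; last by move=> ? ? ?; apply: leq_trans.
    by apply: sort_sorted => p q; apply: leq_total.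
  have : {subset l <= split_pairs d f} by move=> p; rewrite lin.
  elim: (l) lu => //= p s IH /andP[ps us] sub /andP[hp hs].
  rewrite IH // ?andbT; last by move=> q qs; apply: sub; rewrite inE qs orbT.
  apply/allP => q qs; have pq : p != q by apply: contraNneq ps => ->.
  have := allP hp q qs; rewrite /le1.
  have /orP[//|] := hx p q (sub p (mem_head _ _)) (sub q (mem_behead (s := p :: s) qs)) pq.
  by rewrite /crosses => ? ?; exfalso; lia.
(* A step up by [d p - f p] sends the demand clockwise, a step down by [f p] counterclockwise. *)
have [|zs cz hz] := @sol_scaled D (map (fun p => (f p, d p - f p)) l) D0.
  move=> a /mapP[p]; rewrite lin inE => /and3P[pl f0 fd] ->.
  by have [_ ?] := hf p pl; split=> /=; lra.
pose z p := nth 0 zs (index p l).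
have sz : size zs = size l by rewrite (choice_size cz) size_map.
have zsE : map z l = zs.
  apply: (@eq_from_nth _ 0) => [|i]; rewrite size_map ?sz // => il.
  case: l il lu @z {hx lx lin cz hz sz} => // p0 s il lu z.
  by rewrite (nth_map p0) // /z index_uniq.
have cz' p : p \in l -> z p = d p - f p \/ z p = - f p.
  move: cz; rewrite -zsE; elim: (l) => //= q s IH [hq /IH{}IH].
  by rewrite inE => /orP[/eqP ->|].
pose g p := if p \in l then f p + z p else f p.
exists g; split.
  move=> p pl; rewrite /g; case: ifPn => [/cz' [] ->|]; [right; ring|left; ring|].
  rewrite lin inE pl /= negb_and -!leNgt; have [/andP[f0 fd] _] := hf p pl.
  by case/orP => h; [left|right]; apply/eqP; rewrite eq_le h ?f0 ?fd.
move=> e; rewrite pair_loadB.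
have -> : \sum_(p : 'I_n * 'I_n | (p.1 < p.2)%N) sign (on_cw p e) * (g p - f p) =
    \sum_(p <- l) (if on_cw p e then z p else - z p).
  rewrite (bigID (mem l)) /= [X in _ + X]big1 ?addr0; last first.
    by move=> p /andP[_ /negbTE pl]; rewrite /g pl subrr mulr0.
  rewrite (big_uniq _ lu) /=; apply: eq_big => p.
    by rewrite lin inE; case: (_ < _)%N.
  by move=> /andP[_ pl]; rewrite /g pl /sign; case: on_cw; ring.
(* Both endpoints increase along [l]. If no clockwise path has ended before [e], those through [e]
   form an initial segment; otherwise all have begun, and the ended ones form an initial segment. *)
have [hall|] := boolP (all (fun p => (p.1 <= e)%N ==> (e < p.2)%N) l).
  have [|k ->] := @prefix_sum _ l (fun p => on_cw p e) z.
    elim: (l) lx hall => //= p s IH /andP[hp hs] /andP[hpe hse].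
    rewrite IH // andbT; apply/allP => q qs; have := allP hp q qs.
    by move: hpe; rewrite /crosses /on_cw; lia.
  by rewrite zsE; apply: le_trans (ler_norm _) (hz k).
move=> /allPn[q ql]; rewrite negb_imply -leqNgt => /andP[q1 q2].
have [|k kE] := @prefix_sum _ l (fun p => ~~ on_cw p e) (fun p => - z p).
  have : {in l, forall p, (p.1 <= e)%N}.
    move=> p pl; have [->//|pq] := eqVneq p q.
    have := hx p q; rewrite -!lin => /(_ pl ql pq); rewrite /crosses; lia.
  elim: (l) lx => //= p s IH /andP[hp hs] he.
  rewrite IH // ?andbT; last by move=> x xs; apply: he; rewrite inE xs orbT.
  apply/allP => x xs; have := allP hp x xs; have := he p (mem_head _ _).
  have := he x (mem_behead (s := p :: s) xs).
  by rewrite /crosses /on_cw; lia.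
have mN t : sum (map (fun p => - z p) t) = - sum (map z t).
  by elim: t => [|p t IH]; rewrite /= ?sum_nil ?oppr0 // !sum_cons IH opprD.
rewrite (eq_bigr (fun p => if ~~ on_cw p e then - z p else - - z p)); last first.
  by move=> p _; case: on_cw; rewrite //= opprK.
rewrite kE -map_take !mN map_take zsE.
have := hz k; rewrite ler_norml => /andP[h _].
lra.
Qed.

End Rounding.

Theorem theorem1 (R : realType) (n : nat) (d : 'I_n -> 'I_n -> R)
    (d_ge0 : forall i j : 'I_n, (i < j)%N -> 0 <= d i j)
    (s : routing R n) (s_split : split_routing d s) :
  exists2 u : routing R n, unsplittable_routing d u &
    forall e : 'I_n, load u e - load s e <= 19%:R / 14%:R * max_demand d.
Proof.
pose dp (p : 'I_n * 'I_n) := d p.1 p.2.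
pose f (p : 'I_n * 'I_n) := cw_flow s p.1 p.2.
have loadE (r : routing R n) (h : 'I_n * 'I_n -> R) e :
    (forall i j : 'I_n, (i < j)%N -> cw_flow r i j = h (i, j) /\ ccw_flow r i j = d i j - h (i, j)) ->
    load r e = pair_load dp h e.
  move=> hr; rewrite /load /pair_load pair_big_dep /=.
  apply: eq_bigr => -[i j] /= ij; have [-> ->] := hr i j ij.
  rewrite !inE /on_cw /dp /=.
  have [he|he] := boolP (i <= e < j)%N; case: ifPn => he'; rewrite ?addr0 ?add0r //; exfalso; lia.
have D0 : 0 <= max_demand d.
  by rewrite /max_demand; elim/big_rec: _ => // i x _ x0; rewrite le_max x0 orbT.
have dD (i j : 'I_n) : (i < j)%N -> d i j <= max_demand d.
  move=> ij; rewrite /max_demand.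
  rewrite (bigD1 i) //= le_max; apply/orP; left.
  by rewrite (bigD1 j) //= le_max lexx.
have [|g1 [g1d g1l g1x]] := @uncross R n dp f.
  move=> [i j] /= ij; have [? ? ?] := s_split i j ij.
  by rewrite /f /dp /=; apply/andP; split; lra.
have [|g [gd gl]] := crossing_rounding D0 _ g1x.
  by move=> [i j] ij; split; [exact: g1d|exact: dD].
exists (Routing (fun i j => g (i, j)) (fun i j => d i j - g (i, j))).
  by move=> i j ij /=; case: (gd (i, j) ij) => ->; [right|left]; rewrite ?subr0 ?subrr.
move=> e; rewrite (loadE _ g) // (loadE s f); last first.
  by move=> i j ij; have [_ _ <-] := s_split i j ij; rewrite addrAC subrr add0r.
by apply: le_trans (gl e); apply: lerB => //; exact: g1l.
Qed.
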